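(* Let $\mathbf A$ be an irreducible Artin–Tits monoid. Then the Charney graph $(\mathscr C,\to)$ of $\mathbf A$ is strongly connected.
   Context: Let $\Sigma$ be a finite non-empty set and $\ell:\Sigma\times\Sigma\to\{2,3,\dots\}\cup\{\infty\}$ a symmetric function. The Artin–Tits monoid $\mathbf A=\mathbf A(\Sigma,\ell)$ is the monoid presented by the generators $\Sigma$ and the relations $abab\cdots=baba\cdots$ (both alternating words of length $\ell(a,b)$) for all $a\neq b$ with $\ell(a,b)<\infty$. Its unit is $\mathbf e$. Put $x\leq_{\mathrm l}y$ iff $y=x\cdot z$ for some $z\in\mathbf A$, and $x\leq_{\mathrm r}y$ iff $y=z\cdot x$ for some $z\in\mathbf A$ (both are partial orders). $\bigvee X$ denotes the least upper bound of $X$ for $\leq_{\mathrm l}$ when it exists, and $a\vee b=\bigvee\{a,b\}$. $\mathbf A$ is of spherical type if $\Delta:=\bigvee\Sigma$ exists; then $\Delta$ is called the Garside element. $\mathbf A$ is irreducible if it is not isomorphic to the direct product of two Artin–Tits monoids. A Garside subset of $\mathbf A$ is a subset containing $\Sigma$, closed under existing $\vee$ (if $a,b$ belong to it and $a\vee b$ exists in $\mathbf A$ then $a\vee b$ belongs to it), and downward closed under $\leq_{\mathrm r}$. There is a smallest Garside subset $\mathcal S$; it is finite and contains $\Sigma\cup\{\mathbf e\}$. For $x,y\in\mathcal S$ write $x\to y$ if $x=\bigvee\{\zeta\in\mathcal S:\zeta\leq_{\mathrm l}x\cdot y\}$. The Charney graph $(\mathscr C,\to)$ is the directed graph with vertex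 set $\mathscr C=\mathcal S\setminus\{\Delta,\mathbf e\}$ if $\mathbf A$ is of spherical type and $\mathscr C=\mathcal S\setminus\{\mathbf e\}$ otherwise, with edges given by the restriction of $\to$ to $\mathscr C\times\mathscr C$. *)

(* Defs.v *)
From HB Require Import structures.
From mathcomp Require Import all_boot monoid.
From mathcomp Require Import boolp classical_sets.
From Stdlib Require Import Relations.Relation_Operators.

Set Implicit Arguments.
Unset Strict Implicit.
Unset Printing Implicit Defensive.

Local Open Scope classical_set_scope.
Local Open Scope quotient_scope.
Local Open Scope group_scope.

(* The value [None] of a label stands for infinity. *)
Definition artin_tits_label (Sigma : finType)
    (l : Sigma -> Sigma -> option nat) : Prop :=
  [/\ 0 < #|Sigma|,
      forall a b, l a b = l b a &
      forall a b n, l a b = Some n -> 2 <= n]%N.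

Section ArtinTitsMonoid.
Variables (Sigma : finType) (l : Sigma -> Sigma -> option nat).
Implicit Types (a b : Sigma) (u v w : seq Sigma) (n : nat).

(* [altword a b n] is the word a b a b ... of length [n]. *)
Fixpoint altword a b n : seq Sigma :=
  if n is m.+1 then a :: altword b a m else [::].

Inductive at_cong : seq Sigma -> seq Sigma -> Prop :=
| at_braid a b n : a != b -> l a b = Some n ->
    at_cong (altword a b n) (altword b a n)
| at_refl u : at_cong u u
| at_sym u v : at_cong u v -> at_cong v u
| at_trans u v w : at_cong u v -> at_cong v w -> at_cong u w
| at_cat u u' v v' : at_cong u u' -> at_cong v v' ->
    at_cong (u ++ v) (u' ++ v').

Definition at_congb : rel (seq Sigma) := fun u v => `[< at_cong u v >].

Lemma at_congb_refl : reflexive at_congb.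
Proof. by move=> u; apply/asboolP; apply: at_refl. Qed.

Lemma at_congb_sym : symmetric at_congb.
Proof. by move=> u v; apply/asboolP/asboolP; apply: at_sym. Qed.

Lemma at_congb_trans : transitive at_congb.
Proof.
by move=> v u w /asboolP uv /asboolP vw; apply/asboolP; apply: at_trans vw.
Qed.

Canonical at_equiv :=
  EquivRel at_congb at_congb_refl at_congb_sym at_congb_trans.

Definition artin_tits := {eq_quot at_equiv}.

HB.instance Definition _ := Choice.on artin_tits.

Definition at_class u : artin_tits := \pi_{eq_quot at_equiv} u.

Lemma at_classP u v : at_class u = at_class v <-> at_cong u v.
Proof.
by split=> [/eqmodP/asboolP //|uv]; apply/eqmodP/asboolP.
Qed.

Lemma at_class_repr (x : artin_tits) :
  at_class (repr (x : {eq_quot at_equiv})) = x.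
Proof. exact: reprK. Qed.

Definition at_one : artin_tits := at_class [::].

Definition at_mul (x y : artin_tits) : artin_tits :=
  at_class (repr (x : {eq_quot at_equiv}) ++ repr (y : {eq_quot at_equiv})).

Lemma at_mulE u v : at_mul (at_class u) (at_class v) = at_class (u ++ v).
Proof.
by apply/at_classP; apply: at_cat; apply/at_classP; apply: at_class_repr.
Qed.

Lemma at_mulA : associative at_mul.
Proof.
move=> x y z; rewrite -(at_class_repr x) -(at_class_repr y) -(at_class_repr z).
by rewrite !at_mulE catA.
Qed.

Lemma at_mul1 : left_id at_one at_mul.
Proof. by move=> x; rewrite -(at_class_repr x) at_mulE. Qed.

Lemma at_mulr1 : right_id at_one at_mul.
Proof. by move=> x; rewrite -(at_class_repr x) at_mulE cats0. Qed.

HB.instance Definition _ :=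
  isMonoid.Build artin_tits at_mulA at_mul1 at_mulr1.

Definition at_gen a : artin_tits := at_class [:: a].

Definition at_gens : set artin_tits := range at_gen.

End ArtinTitsMonoid.

Arguments at_gen {Sigma} l a.
Arguments at_gens {Sigma} l.

Definition monoid_isomorphic (M N : monoidType) : Prop :=
  exists2 f : M -> N, monoid_morphism f & bijective f.

Definition at_irreducible (M : monoidType) : Prop :=
  ~ exists (Sigma1 Sigma2 : finType)
           (l1 : Sigma1 -> Sigma1 -> option nat)
           (l2 : Sigma2 -> Sigma2 -> option nat),
      [/\ artin_tits_label l1, artin_tits_label l2 &
          monoid_isomorphic M (artin_tits l1 * artin_tits l2)%type].

Definition leL (M : monoidType) (x y : M) : Prop := exists z, y = x * z.

Definition leR (M : monoidType) (x y : M) : Prop := exists z, y = z * x.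

Definition is_lub (M : monoidType) (X : set M) (y : M) : Prop :=
  (forall x, X x -> leL x y) /\
  (forall z, (forall x, X x -> leL x z) -> leL y z).

Section Charney.
Variables (Sigma : finType) (l : Sigma -> Sigma -> option nat).
Local Notation A := (artin_tits l).
Implicit Types (x y : A) (G : set A).

Definition garside_subset G : Prop :=
  [/\ at_gens l `<=` G,
      forall a b c, G a -> G b -> is_lub [set a; b] c -> G c &
      forall x y, G y -> leR x y -> G x].

(* The three conditions are stable under intersection, so this is the smallest
   Garside subset. *)
Definition smallest_garside : set A :=
  \bigcap_(G in [set G | garside_subset G]) G.

Lemma smallest_garsideP :
  garside_subset smallest_garside /\
  forall G, garside_subset G -> smallest_garside `<=` G.
Proof.
split; last by move=> G GG x; apply.
split=> [x Sx G GG|a b c Sa Sb abc G GG|x y Sy xy G GG]; case: (GG).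
- by move=> + _ _; apply.
- by move=> _ + _ => /(_ a b c); apply => //; [apply: Sa | apply: Sb].
- by move=> _ _ /(_ x y); apply => //; apply: Sy.
Qed.

Definition normal_step x y : Prop :=
  is_lub [set z | smallest_garside z /\ leL z (x * y)] x.

Definition garside_element x : Prop := is_lub (at_gens l) x.

(* [garside_element] is the singleton of Delta when the monoid is of spherical
   type, and is empty otherwise. *)
Definition charney_vertex : set A :=
  smallest_garside `\` ([set Delta | garside_element Delta] `|` [set 1]).

Definition charney_edge x y : Prop :=
  [/\ charney_vertex x, charney_vertex y & normal_step x y].

End Charney.

Arguments garside_subset {Sigma} l G.
Arguments smallest_garside {Sigma} l.
Arguments normal_step {Sigma} l x y.
Arguments garside_element {Sigma} l x.
Arguments charney_vertex {Sigma} l.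
Arguments charney_edge {Sigma} l x y.

Definition strongly_connected (T : Type) (V : set T) (E : T -> T -> Prop) :
    Prop :=
  forall x y, V x -> V y -> clos_refl_trans T E x y.

(* Main.v *)
From Stdlib Require Import Reals Lra Relations.Relation_Operators.
From mathcomp Require Import boolp classical_sets.
From mathcomp Require Import all_boot monoid.
Require Import Defs.

Set Implicit Arguments.
Unset Strict Implicit.
Unset Printing Implicit Defensive.

Local Open Scope group_scope.
Delimit Scope R_scope with re.

(** Call an element of the monoid squarefree when none of its factorisations
    repeats a letter twice in a row.  All elements of the smallest Garside
    subset S are squarefree ([squarefree_garside]); hence x -> y as soon as
    every first letter of y is a last letter of x ([normal_step_heads]), since
    a longer head of x y would contain such a letter twice in a row.

    In particular every vertex has an edge to one of its last letters.  If
    the label of s and t is not 2, then s reaches t, through the vertex s t or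
    directly according to whether s t belongs to S ([reach_neighbor]).
    Irreducibility says that the graph of these labels is connected
    ([irreducible_cut]), so all generators reach each other.

    It remains to reach a vertex y from a generator.  The set I of its first
    letters has a least upper bound D, and the last letters of D include I
    ([delta_tails]), so D -> y.  Let s be outside I, linked to a letter of I
    (that is, with a label other than 2).  If w is a longest product of
    letters of I such that s w is in S, then s w -> D by maximality, and the
    first letters of s w are s and some letters of I that commute with s
    ([predecessor]).  Picture a token on every letter of I: the empty site s
    absorbs the tokens of all its neighbours, and other tokens may vanish.  On
    a connected graph with an empty site this process can bring the tokens
    together until one is left, and then y is the target of an edge from a
    generator ([reach_from_gen]).

    This rests on the fact that Artin-Tits monoids are left cancellative and
    that two elements with a common multiple have a least one.  Both follow
    from the reduction lemma of Garside, Brieskorn and Saito: if a x = b y with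
    a, b distinct letters, then a x is a multiple of the braid word of a and b
    ([reduction]).  The classical proof treats the finite types of rank three
    one by one.  Here they are treated uniformly by Mozes' numbers game, that
    is, by the contragredient of the geometric representation of the Coxeter
    group, acting on the orbit of a single positive vector.  The braid
    relations preserve both the outcome and the legality of a play
    ([cong_play]), and an element is squarefree exactly when its words are
    legal plays ([reducedP]).  This yields for squarefree elements the exchange
    property, cancellation and the reduction lemma, with no induction on the
    type.  The general reduction lemma follows by induction on the length
    ([same_or_cross_trans]): an equality a x = c z = b y exhibits a common
    multiple z of the complements of a and b after c, their least upper bound m
    exists in smaller length, c m is squarefree, and the result for squarefree
    elements applies to c m. *)

(** * Chebyshev sequences *)

(** Chebyshev polynomials of the second kind, shifted by one: at c = 2 cos t the
    value is sin (k t) / sin t. *)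
Fixpoint cheb (c : R) (k : nat) : R :=
  match k with
  | 0 => 0%re
  | 1 => 1%re
  | (j.+1 as i).+1 => (c * cheb c i - cheb c j)%re
  end.

Lemma chebSS c k : cheb c k.+2 = (c * cheb c k.+1 - cheb c k)%re.
Proof. by []. Qed.

Fixpoint cheb_sum c (p : pred nat) k : R :=
  if k is j.+1 then (cheb_sum c p j + (if p j then cheb c j else 0))%re
  else 0%re.

Local Notation odd_sum c := (cheb_sum c odd).
Local Notation even_sum c := (cheb_sum c (fun j => ~~ odd j)).

(** In an alternating play, the total fired at each of the two letters is a
    combination of sums of every other term of the Chebyshev sequence; these two
    recurrences follow it when one move is added at the front. *)
Lemma odd_sumSS c k :
  odd_sum c k.+2 = (1 + c * even_sum c k.+1 - odd_sum c k)%re.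
Proof.
elim: k => [|k IH]; first by rewrite /=; lra.
have -> : odd_sum c k.+3
    = (odd_sum c k.+2 + (if odd k.+2 then cheb c k.+2 else 0))%re by [].
rewrite IH chebSS.
have -> : even_sum c k.+2
    = (even_sum c k.+1 + (if odd k.+2 then cheb c k.+1 else 0))%re.
  by [].
rewrite [odd_sum c k.+1]/= oddS oddS negbK; case: (odd k); lra.
Qed.

Lemma even_sumSS c k : even_sum c k.+2 = (c * odd_sum c k.+1 - even_sum c k)%re.
Proof.
elim: k => [|k IH]; first by rewrite /=; lra.
have -> : even_sum c k.+3
    = (even_sum c k.+2 + (if ~~ odd k.+2 then cheb c k.+2 else 0))%re by [].
rewrite IH chebSS.
have -> : odd_sum c k.+2
    = (odd_sum c k.+1 + (if odd k.+1 then cheb c k.+1 else 0))%re by [].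
have -> : even_sum c k.+1
    = (even_sum c k + (if ~~ odd k then cheb c k else 0))%re by [].
by rewrite !oddS negbK; case: (odd k) => /=; lra.
Qed.

(** Minus the off-diagonal Cartan entry.  The value 2 at infinity is the limit of
    the finite case, and makes the Chebyshev sequence positive for ever. *)
Definition label_weight (m : option nat) : R :=
  if m is Some n then (2 * cos (PI / INR n))%re else 2%re.

(** The bound on the length of alternating squarefree words. *)
Definition within (m : option nat) k := if m is Some n then k <= n else true.

Lemma cheb_sin t k : (cheb (2 * cos t) k * sin t = sin (INR k * t))%re.
Proof.
have [] : (cheb (2 * cos t) k * sin t = sin (INR k * t))%re
        /\ (cheb (2 * cos t) k.+1 * sin t = sin (INR k.+1 * t))%re; last by [].
elim: k => [|k [IH1 IH2]]; first by rewrite /= !Rmult_0_l sin_0 Rmult_1_l Rmult_1_l.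
split=> //; rewrite chebSS.
have -> : (INR k.+2 * t = INR k.+1 * t + t)%re by rewrite !S_INR; ring.
have {}IH1 : (cheb (2 * cos t) k * sin t = sin (INR k.+1 * t - t))%re.
  by rewrite IH1; congr sin; rewrite S_INR; ring.
move: IH1; rewrite sin_plus sin_minus -IH2; set x := cheb _ k.+1; nra.
Qed.

Lemma cheb2 k : cheb 2 k = INR k.
Proof.
have [] : cheb 2 k = INR k /\ cheb 2 k.+1 = INR k.+1; last by [].
elim: k => [|k [IH1 IH2]]; first by [].
by split=> //; rewrite chebSS IH1 IH2 !S_INR; lra.
Qed.

Lemma angle_bounds n : 1 < n -> (0 < PI / INR n < PI)%re.
Proof.
move=> n1; have : (1 < INR n)%re by apply: lt_1_INR; apply/ltP.
move=> h; have := PI_RGT_0 => p; split; first by apply: Rdiv_lt_0_compat; lra.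
apply: (Rmult_lt_reg_r (INR n)); first lra.
by rewrite /Rdiv Rmult_assoc Rinv_l; nra.
Qed.

Lemma cheb_label0 n : 1 < n -> cheb (label_weight (Some n)) n = 0%re.
Proof.
move=> n1; have /= := angle_bounds n1; set t := (PI / INR n)%re => tb.
have := cheb_sin t n.
have -> : (INR n * t = PI)%re.
  rewrite /t; field; apply: not_0_INR => n0; by rewrite n0 in n1.
rewrite sin_PI; have := sin_gt_0 t; set x := cheb _ _; nra.
Qed.

Lemma cheb_label_gt0 m k :
  (forall n, m = Some n -> 1 < n /\ k < n) -> 0 < k -> (0 < cheb (label_weight m) k)%re.
Proof.
case: m => [n|] /= hk k0; last by rewrite cheb2; apply: lt_0_INR; apply/ltP.
have [n1 kn] := hk n erefl.
have /= := angle_bounds n1; set t := (PI / INR n)%re => tb.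
have : (0 < sin (INR k * t))%re.
  have k0' : (0 < INR k)%re by apply: lt_0_INR; apply/ltP.
  have n0' : (INR k < INR n)%re by apply: lt_INR; apply/ltP.
  apply: sin_gt_0; first nra.
  have <- : (INR n * t = PI)%re by rewrite /t; field; lra.
  nra.
rewrite -cheb_sin; have := sin_gt_0 t; set x := cheb _ _; nra.
Qed.

Lemma cheb_label_ge0 m k :
  (forall n, m = Some n -> 1 < n) -> within m k -> (0 <= cheb (label_weight m) k)%re.
Proof.
case: k => [|k] m1 mk; first by apply: Rle_refl.
case: m m1 mk => [n|] m1 mk.
  have n1 := m1 n erefl.
  have : k.+1 <= n by [].
  rewrite leq_eqVlt => /orP[/eqP->|kn].
    by rewrite (cheb_label0 n1); lra.
  apply: Rlt_le; apply: (@cheb_label_gt0 (Some n)) => // _ [<-]; by split.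
by apply: Rlt_le; apply: (@cheb_label_gt0 None).
Qed.

(** * The numbers game *)

Section NumbersGame.
Variables (Sigma : finType) (l : Sigma -> Sigma -> option nat).
Hypothesis Hl : artin_tits_label l.
Implicit Types (a b s t : Sigma) (u v w : seq Sigma) (f : Sigma -> R).

Lemma label_sym a b : l a b = l b a. Proof. by case: Hl. Qed.

Lemma label_gt1 a b n : l a b = Some n -> 1 < n.
Proof. by case: Hl => _ _; apply. Qed.

Lemma size_altword a b n : size (altword a b n) = n.
Proof. by elim: n a b => //= n IH a b; rewrite IH. Qed.

Lemma altwordSr a b n :
  altword a b n.+1 = rcons (altword a b n) (if odd n then b else a).
Proof.
elim: n a b => [|n IH] a b //=; first by rewrite -/(altword b a n.+1) IH /= if_neg.
Qed.

Lemma rev_altword a b n :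
  rev (altword a b n) = if odd n then altword a b n else altword b a n.
Proof.
elim: n a b => // n IH a b; rewrite [in LHS]/= rev_cons IH.
by rewrite oddS if_neg !altwordSr; case: (odd n).
Qed.

Lemma altword_add a b n k :
  altword a b (n + k)
  = altword a b n ++ if odd n then altword b a k else altword a b k.
Proof.
by elim: n a b => //= n IH a b; rewrite IH if_neg; case: (odd n).
Qed.

Lemma mem_altword a b n c : c \in altword a b n -> (c == a) || (c == b).
Proof.
elim: n a b => //= n IH a b; rewrite inE => /orP[->//|/IH].
by rewrite orbC.
Qed.

Definition cartan a b : R :=
  if a == b then 2%re else (- label_weight (l a b))%re.

(** The simple reflection in the dual of the geometric representation: f gives
    the values of a linear form at the simple roots. *)
Definition fire f a : Sigma -> R := fun b => (f b - cartan a b * f a)%re.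

Definition play f w := foldl fire f w.

(** A play that fires only positive numbers; it corresponds to a word all of
    whose roots are positive for the starting form. *)
Fixpoint legal f w : Prop :=
  if w is a :: w' then (0 < f a)%re /\ legal (fire f a) w' else True.

Lemma play_cat f u v : play f (u ++ v) = play (play f u) v.
Proof. exact: foldl_cat. Qed.

Lemma legal_cat f u v : legal f (u ++ v) <-> legal f u /\ legal (play f u) v.
Proof.
elim: u f => [|a u IH] f /=; first by split=> // [[]].
by rewrite IH; split=> [[? []]|[[]]].
Qed.

Lemma fire_self f a : fire f a a = (- f a)%re.
Proof. by rewrite /fire /cartan eqxx; lra. Qed.

Lemma fireK a : involutive (fire^~ a).
Proof.
by move=> f; apply: funext => b; rewrite {1}/fire fire_self /fire; lra.
Qed.

Lemma fire_other f a b : a != b ->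
  fire f a b = (f b + label_weight (l a b) * f a)%re.
Proof. by move=> ab; rewrite /fire /cartan (negbTE ab); lra. Qed.

(** The value about to be fired after k alternating moves: the two letters span
    an invariant plane, on which the game is the Chebyshev recurrence. *)
Lemma play_altword_next a b f k : a != b ->
  play f (altword a b k) (if odd k then b else a)
  = (f a * cheb (label_weight (l a b)) k.+1
     + f b * cheb (label_weight (l a b)) k)%re.
Proof.
elim: k a b f => [|k IH] a b f ab; first by rewrite /=; lra.
rewrite [altword _ _ _]/= -[play _ _]/(play (fire f a) (altword b a k)).
have -> : (if odd k.+1 then b else a) = if odd k then a else b.
  by rewrite oddS if_neg.
rewrite IH 1?eq_sym // (fire_other _ ab) fire_self chebSS (label_sym b a); ring.
Qed.

Lemma play_altword a b f k c : a != b ->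
  let E := even_sum (label_weight (l a b)) in
  let O := odd_sum (label_weight (l a b)) in
  play f (altword a b k) c
  = (f c - cartan a c * (f a * O k.+1 + f b * E k)
         - cartan b c * (f a * E k.+1 + f b * O k))%re.
Proof.
elim: k a b f => [|k IH] a b f ab E O.
  by rewrite /E /O /=; lra.
rewrite [altword _ _ _]/= -[play _ _]/(play (fire f a) (altword b a k)).
rewrite IH 1?eq_sym // (fire_other _ ab) fire_self (label_sym b a) -/E -/O.
by rewrite /E /O odd_sumSS even_sumSS /fire; ring.
Qed.

(** The two closed forms given by [play_altword] differ by multiples of the n-th
    Chebyshev value, which vanishes. *)
Lemma play_braid a b n f : a != b -> l a b = Some n ->
  play f (altword a b n) = play f (altword b a n).
Proof.
move=> ab lab; apply: funext => c.
have F0 : cheb (label_weight (l a b)) n = 0%re.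
  by rewrite lab; apply: cheb_label0; apply: label_gt1 lab.
rewrite (play_altword f n c ab) (play_altword f n c (a := b)) 1?eq_sym //.
by rewrite (label_sym b a) /= F0 !if_same; ring.
Qed.

Lemma legal_altword a b f k : a != b ->
  legal f (altword a b k) <->
  forall j, j < k ->
    (0 < f a * cheb (label_weight (l a b)) j.+1
         + f b * cheb (label_weight (l a b)) j)%re.
Proof.
elim: k a b f => [|k IH] a b f ab; first by split.
rewrite [altword _ _ _]/= -[legal _ _]/(_ /\ legal (fire f a) (altword b a k)).
rewrite IH 1?eq_sym // (fire_other _ ab) fire_self (label_sym b a).
have E j : ((f b + label_weight (l a b) * f a) * cheb (label_weight (l a b)) j.+1
   + - f a * cheb (label_weight (l a b)) j =
  f a * cheb (label_weight (l a b)) j.+2 + f b * cheb (label_weight (l a b)) j.+1)%re.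
  by rewrite chebSS; ring.
split=> [[fa h] [_|j jk]|h]; first by rewrite /=; lra.
- by rewrite -E; apply: h.
- by split=> [|j jk]; [have := h 0 isT; rewrite /=; lra|rewrite E; apply: h].
Qed.

Lemma dihedral_pos a b f j : a != b -> (0 < f a)%re -> (0 < f b)%re ->
  within (l a b) j.+1 ->
  (0 < f a * cheb (label_weight (l a b)) j.+1
       + f b * cheb (label_weight (l a b)) j)%re.
Proof.
move=> ab fa fb wj.
have g1 n : l a b = Some n -> 1 < n by apply: label_gt1.
have ge1 := cheb_label_ge0 g1 wj.
have wj' : within (l a b) j by case: (l a b) wj => //= n /ltnW.
have ge0 := cheb_label_ge0 g1 wj'.
case: (posnP j) => [j0|j0].
  by rewrite j0 /=; nra.
have : (0 < cheb (label_weight (l a b)) j)%re.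
  apply: cheb_label_gt0 => // n lab; split; first exact: g1.
  by move: wj; rewrite lab.
set x := cheb _ _ in ge1 *; set y := cheb _ _ in ge0 *; nra.
Qed.

Lemma legal_altword_pos a b f k : a != b -> (0 < f a)%re -> (0 < f b)%re ->
  within (l a b) k -> legal f (altword a b k).
Proof.
move=> ab fa fb wk; apply/(legal_altword f k ab) => j jk.
by apply: dihedral_pos => //; case: (l a b) wk => //= n; apply: leq_trans.
Qed.

(** Legality of an alternating play of full length n is symmetric in the two
    letters: its first and its last fired numbers are positive multiples of the
    two starting numbers, and their positivity is sufficient. *)
Lemma legal_braid a b n f : a != b -> l a b = Some n ->
  legal f (altword a b n) -> legal f (altword b a n).
Proof.
move=> ab lab; have n1 := label_gt1 lab.
move=> /(legal_altword f n ab) h.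
have fa : (0 < f a)%re by have := h 0 (ltnW n1); rewrite /=; lra.
have n0 : 0 < n.-1 by case: (n) n1 => [|[]].
have nK : n.-1.+1 = n by rewrite prednK // ltnW.
have fb : (0 < f b)%re.
  have := h n.-1; rewrite nK leqnn => /(_ isT).
  rewrite lab (cheb_label0 n1).
  have : (0 < cheb (label_weight (Some n)) n.-1)%re.
    by apply: cheb_label_gt0 n0 => _ [<-]; rewrite nK.
  move: (cheb _ _) => x; nra.
apply: legal_altword_pos => //; first by rewrite eq_sym.
by rewrite label_sym lab /=.
Qed.

Lemma cong_play u v : at_cong l u v ->
  forall f, play f u = play f v /\ (legal f u <-> legal f v).
Proof.
elim=> {u v} [a b n ab lab f|u f|u v _ IH f|u v w _ IH1 _ IH2 f
  |u u' v v' _ IH1 _ IH2 f].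
- split; first exact: play_braid.
  by split; apply: legal_braid; rewrite // 1?eq_sym // label_sym.
- by [].
- by have [-> ->] := IH f.
- by have [-> ->] := IH1 f.
- rewrite !play_cat !legal_cat; have [-> ->] := IH1 f.
  by have [-> ->] := IH2 (play f u').
Qed.

End NumbersGame.

(** * Words and elements of the monoid *)

Section Elements.
Variables (Sigma : finType) (l : Sigma -> Sigma -> option nat).
Hypothesis Hl : artin_tits_label l.
Implicit Types (a b s t : Sigma) (u v w : seq Sigma) (f : Sigma -> R).

Local Notation A := (artin_tits l).
Local Notation cl := (at_class l).
Local Notation gen := (at_gen l).
Implicit Types (x y z g : A) (I : {set Sigma}) (n k : nat).

Definition word x : seq Sigma := repr (x : {eq_quot (at_equiv l)}%qT).

Lemma wordK x : cl (word x) = x.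
Proof. exact: at_class_repr. Qed.

Lemma word_class w : at_cong l (word (cl w)) w.
Proof. by apply/at_classP; rewrite wordK. Qed.

Lemma class_cat u v : cl (u ++ v) = cl u * cl v.
Proof. by symmetry; apply: at_mulE. Qed.

Lemma class_cons a u : cl (a :: u) = gen a * cl u.
Proof. by rewrite -class_cat. Qed.

Lemma class_rcons u a : cl (rcons u a) = cl u * gen a.
Proof. by rewrite -cats1 class_cat. Qed.

Lemma class_nil : cl [::] = 1.
Proof. by []. Qed.

Lemma braid a b n : a != b -> l a b = Some n ->
  cl (altword a b n) = cl (altword b a n).
Proof. by move=> ab lab; apply/at_classP; apply: at_braid. Qed.

Lemma cong_size u v : at_cong l u v -> size u = size v.
Proof.
elim=> {u v} [a b n _ _|//|//|u v w _ -> _ -> //|u u' v v' _ e1 _ e2].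
  by rewrite !size_altword.
by rewrite !size_cat e1 e2.
Qed.

(** A braid relation has length at least 2, so both sides have the same letters. *)
Lemma cong_all (p : pred Sigma) u v : at_cong l u v -> all p u = all p v.
Proof.
elim=> {u v} [a b n _ lab|//|//|u v w _ -> _ -> //|u u' v v' _ e1 _ e2].
  case: n lab => [|[|n]] lab; try by have := label_gt1 Hl lab.
  have E c d : all p (altword c d n.+2) = p c && p d.
    rewrite /= andbA; case: (boolP (p c && p d)) => //= /andP[pc pd].
    by apply/allP => e /mem_altword /orP[] /eqP ->.
  by rewrite !E andbC.
by rewrite !all_cat e1 e2.
Qed.

Lemma cong_rev u v : at_cong l u v -> at_cong l (rev u) (rev v).
Proof.
elim=> {u v} [a b n ab lab|u|u v _|u v w _ IH1 _|u u' v v' _ IH1 _ IH2].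
- rewrite !rev_altword; case: (odd n); first exact: at_braid.
  by apply: at_braid; rewrite 1?eq_sym // (label_sym Hl).
- exact: at_refl.
- exact: at_sym.
- exact: at_trans.
- by rewrite !rev_cat; apply: at_cat.
Qed.

Definition len x := size (word x).

Lemma len_class w : len (cl w) = size w.
Proof. exact: cong_size (word_class w). Qed.

Lemma lenM x y : len (x * y) = len x + len y.
Proof.
by rewrite -[in LHS](wordK x) -[in LHS](wordK y) -class_cat len_class size_cat.
Qed.

Lemma len1 : len 1 = 0. Proof. by rewrite -class_nil len_class. Qed.

Lemma len_gen a : len (gen a) = 1%N. Proof. by rewrite len_class. Qed.

Lemma len_eq0 x : len x = 0 -> x = 1.
Proof. by move=> /size0nil x0; rewrite -(wordK x) x0. Qed.

Lemma split_head x : x <> 1 -> exists a y, x = gen a * y.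
Proof.
rewrite -(wordK x); case: (word x) => [//|a w] _.
by exists a, (cl w); rewrite class_cons.
Qed.

Lemma split_last x : x <> 1 -> exists y a, x = y * gen a.
Proof.
rewrite -(wordK x); case/lastP: (word x) => [//|w a] _.
by exists (cl w), a; rewrite class_rcons.
Qed.

Lemma leL_mulr x y : leL x (x * y). Proof. by exists y. Qed.
Lemma leL_refl x : leL x x. Proof. by exists 1; rewrite mulg1. Qed.
Lemma leL_1 x : leL 1 x. Proof. by exists x; rewrite mul1g. Qed.
Lemma leL_trans y x z : leL x y -> leL y z -> leL x z.
Proof. by move=> [u ->] [v ->]; exists (u * v); rewrite mulgA. Qed.
Lemma leL_mul2 g x y : leL x y -> leL (g * x) (g * y).
Proof. by move=> [u ->]; rewrite mulgA; apply: leL_mulr. Qed.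
Lemma leL_len x y : leL x y -> len x <= len y.
Proof. by move=> [u ->]; rewrite lenM leq_addr. Qed.

Lemma leL_len_eq x y : leL x y -> len y <= len x -> x = y.
Proof.
move=> [u ->]; rewrite lenM -[X in _ <= X]addn0 leq_add2l leqn0 => /eqP u0.
by rewrite (len_eq0 u0) mulg1.
Qed.

Lemma leL_anti x y : leL x y -> leL y x -> x = y.
Proof. by move=> xy /leL_len; apply: leL_len_eq. Qed.

Lemma leR_mull x y : leR x (y * x). Proof. by exists y. Qed.

(** Membership in the submonoid generated by I. *)
Definition supported (I : {set Sigma}) x := all (mem I) (word x).

Lemma supported_class I w : supported I (cl w) = all (mem I) w.
Proof. exact: cong_all (word_class w). Qed.

Lemma supportedM I x y : supported I (x * y) = supported I x && supported I y.
Proof.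
by rewrite -[in LHS](wordK x) -[in LHS](wordK y) -class_cat supported_class all_cat.
Qed.

Lemma supported_gen I a : supported I (gen a) = (a \in I).
Proof. by rewrite supported_class /= andbT. Qed.

Lemma supported_altword I a b n : a \in I -> b \in I ->
  supported I (cl (altword a b n)).
Proof.
move=> aI bI; rewrite supported_class; apply/allP => c /mem_altword.
by case/orP => /eqP ->.
Qed.

(** The anti-automorphism reversing words; it exchanges left and right
    divisibility. *)
Definition mirror x : A := cl (rev (word x)).

Lemma mirror_class w : mirror (cl w) = cl (rev w).
Proof. by apply/at_classP; apply: cong_rev; apply: word_class. Qed.

Lemma mirrorM x y : mirror (x * y) = mirror y * mirror x.
Proof.
rewrite -[in LHS](wordK x) -[in LHS](wordK y) -class_cat mirror_class rev_cat.
by rewrite class_cat.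
Qed.

Lemma mirrorK : involutive mirror.
Proof.
by move=> x; rewrite -(wordK x) !mirror_class revK.
Qed.

Lemma mirror_gen a : mirror (gen a) = gen a.
Proof. by rewrite mirror_class. Qed.

Lemma leL_mirror x y : leL x y <-> leR (mirror x) (mirror y).
Proof.
split=> [[z ->]|[z]]; first by rewrite mirrorM; apply: leR_mull.
by move/(congr1 mirror); rewrite mirrorM !mirrorK => ->; apply: leL_mulr.
Qed.

End Elements.

(** * Direct products and irreducibility *)

Section DirectProduct.
Variables (Sigma : finType) (l : Sigma -> Sigma -> option nat).
Hypothesis Hl : artin_tits_label l.

Local Notation A := (artin_tits l).
Local Notation cl := (at_class l).
Local Notation gen := (at_gen l).
Implicit Types (a b c s t : Sigma) (x y z g w : A) (I J : {set Sigma}) (n k : nat).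

Section Parabolic.
Variable J : {set Sigma}.

Definition sub_label (a b : {s : Sigma | s \in J}) := l (val a) (val b).
Local Notation lJ := sub_label.

Definition restrict_word (u : seq Sigma) : seq {s : Sigma | s \in J} := pmap insub u.
Definition extend_word (u : seq {s : Sigma | s \in J}) : seq Sigma := map val u.

Lemma restrict_extend u : restrict_word (extend_word u) = u.
Proof. exact: map_pK (@valK _ _ _) _. Qed.

Lemma extend_restrict u : extend_word (restrict_word u) = filter (mem J) u.
Proof.
rewrite /extend_word /restrict_word (pmap_filter (insubK _)).
by apply: eq_filter => a; rewrite isSome_insub.
Qed.

Lemma extend_altword (a b : {s : Sigma | s \in J}) n :
  extend_word (altword a b n) = altword (val a) (val b) n.
Proof. by elim: n a b => //= n IH a b; rewrite -IH. Qed.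

Lemma extend_cong u v : at_cong lJ u v -> at_cong l (extend_word u) (extend_word v).
Proof.
elim=> {u v} [a b n ab lab|u|u v _|u v w _ IH1 _|u u' v v' _ IH1 _ IH2].
- by rewrite !extend_altword; apply: at_braid.
- exact: at_refl.
- exact: at_sym.
- exact: at_trans.
- by rewrite /extend_word !map_cat; apply: at_cat.
Qed.

Lemma sub_label_artin : J != set0 -> artin_tits_label lJ.
Proof.
move=> /set0Pn[a aJ]; split=> [|b c|b c n]; last exact: (label_gt1 Hl).
  by apply/card_gt0P; exists (Sub a aJ).
exact: (label_sym Hl).
Qed.

Hypothesis cross2 : forall s t, s \notin J -> t \in J -> l s t = Some 2.

Lemma restrict_cong u v :
  at_cong l u v -> at_cong lJ (restrict_word u) (restrict_word v).
Proof.
elim=> {u v} [a b n ab lab|u|u v _|u v w _ IH1 _|u u' v v' _ IH1 _ IH2].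
- have [aJ | aJ] := boolP (a \in J); have [bJ | bJ] := boolP (b \in J).
  + pose a' : {s | s \in J} := Sub a aJ; pose b' : {s | s \in J} := Sub b bJ.
    have E : altword a b n = extend_word (altword a' b' n) by rewrite extend_altword.
    have E' : altword b a n = extend_word (altword b' a' n) by rewrite extend_altword.
    by rewrite E E' !restrict_extend; apply: at_braid.
  + move: lab; rewrite (label_sym Hl) cross2 // => -[<-] /=.
    rewrite /restrict_word /= (@insubN _ _ {s : Sigma | s \in J} _ bJ).
    exact: at_refl.
  + move: lab; rewrite cross2 // => -[<-] /=.
    rewrite /restrict_word /= (@insubN _ _ {s : Sigma | s \in J} _ aJ).
    exact: at_refl.
  + have E c d k : c \notin J -> d \notin J -> restrict_word (altword c d k) = [::].
      elim: k c d => // k IH c d cJ dJ.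
      by rewrite /restrict_word /= (@insubN _ _ {s : Sigma | s \in J} _ cJ) /=; apply: IH.
    by rewrite !E //; apply: at_refl.
- exact: at_refl.
- exact: at_sym.
- exact: at_trans.
- by rewrite /restrict_word !pmap_cat; apply: at_cat.
Qed.

Definition extend (x : artin_tits lJ) : A := cl (extend_word (word x)).
Definition restrict x : artin_tits lJ := at_class lJ (restrict_word (word x)).

Lemma extend_class u : extend (at_class lJ u) = cl (extend_word u).
Proof. by apply/at_classP/extend_cong/word_class. Qed.

Lemma restrict_class u : restrict (cl u) = at_class lJ (restrict_word u).
Proof. by apply/at_classP/restrict_cong/word_class. Qed.

Lemma restrictM x y : restrict (x * y) = restrict x * restrict y.
Proof.
rewrite -[in LHS](wordK x) -[in LHS](wordK y) -class_cat restrict_class.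
by rewrite /restrict_word pmap_cat class_cat.
Qed.

Lemma restrict1 : restrict 1 = 1.
Proof. by rewrite -class_nil restrict_class. Qed.

Lemma extendK : cancel extend restrict.
Proof. by move=> x; rewrite restrict_class restrict_extend wordK. Qed.

End Parabolic.

(** Letters outside J can be moved to the right across the letters of J. *)
Lemma class_filter_split J u :
  (forall s t, s \notin J -> t \in J -> l s t = Some 2) ->
  cl (filter (mem J) u) * cl (filter (mem (~: J)) u) = cl u.
Proof.
move=> cross2.
have comm a v : a \notin J ->
  gen a * cl (filter (mem J) v) = cl (filter (mem J) v) * gen a.
  move=> aJ; elim: v => [|b v IH] /=; first by rewrite class_nil mulg1 mul1g.
  case: ifP => // bJ; have ab : a != b by apply: contraNneq aJ => ->.
  rewrite class_cons -mulgA -IH !mulgA; congr (_ * _).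
  by have := braid ab (cross2 _ _ aJ bJ); rewrite /= !class_cons class_nil !mulg1.
elim: u => [|a u IH] /=; first by rewrite !class_nil mulg1.
rewrite !inE; case: (boolP (a \in J)) => aJ /=.
  by rewrite !class_cons -mulgA IH.
by rewrite [in LHS]class_cons mulgA -comm // -mulgA IH -class_cons.
Qed.

(** If all labels across the cut were 2, then restricting words to J and to its
    complement would be an isomorphism onto a direct product. *)
Lemma irreducible_cut J : at_irreducible A -> J != set0 -> J != setT ->
  exists s t, [/\ s \notin J, t \in J & l s t <> Some 2].
Proof.
move=> irr J0 JT; apply: contrapT => ncut; apply: irr.
have cross2 s t : s \notin J -> t \in J -> l s t = Some 2.
  by move=> sJ tJ; apply: contrapT => lst; apply: ncut; exists s, t.
have cross2' s t : s \notin ~: J -> t \in ~: J -> l s t = Some 2.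
  by rewrite !inE negbK => sJ tJ; rewrite (label_sym Hl) cross2.
have JC0 : ~: J != set0 by rewrite -setCT (inj_eq (@setC_inj _)).
exists {s : Sigma | s \in J}, {s : Sigma | s \in ~: J}, (@sub_label J),
  (@sub_label (~: J)).
split; [exact: sub_label_artin | exact: sub_label_artin |].
exists (fun x => (restrict J x, restrict (~: J) x)).
  by split=> [|x y]; rewrite ?restrict1 // !restrictM.
exists (fun p => extend p.1 * extend p.2) => [x|[y z]] /=.
  rewrite -(wordK x) !restrict_class // !extend_class // !extend_restrict.
  exact: class_filter_split.
have off (K L : {set Sigma}) v :
  [disjoint K & L] -> @restrict_word K (@extend_word L v) = [::].
  move=> KL; elim: v => //= b v IH; rewrite /restrict_word /=.
  rewrite (@insubN _ _ {s : Sigma | s \in K}) //=.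
  by rewrite (disjointFl KL) // (valP b).
have dJ : [disjoint J & ~: J] by rewrite -setI_eq0 setICr.
rewrite !restrictM // !extendK //.
have -> : restrict J (extend z) = 1.
  by rewrite restrict_class // off // class_nil.
have -> : restrict (~: J) (extend y) = 1.
  by rewrite restrict_class // off // 1?disjoint_sym // class_nil.
by rewrite mulg1 mul1g.
Qed.

End DirectProduct.

(** * Squarefree elements *)

Section Charney.
Variables (Sigma : finType) (l : Sigma -> Sigma -> option nat).
Hypothesis Hl : artin_tits_label l.

Local Notation A := (artin_tits l).
Local Notation cl := (at_class l).
Local Notation gen := (at_gen l).
Local Notation S := (smallest_garside l).
Local Notation vertex := (charney_vertex l).
Local Notation reach := (clos_refl_trans A (charney_edge l)).
Implicit Types (a b c s t : Sigma) (x y z g w : A) (I J : {set Sigma}) (n k : nat).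

(** The elements represented by reduced words of the Coxeter group. *)
Definition squarefree x := forall (u v : A) a, x <> u * gen a * gen a * v.

Lemma squarefreeMl x y : squarefree (x * y) -> squarefree x.
Proof. by move=> h u v a E; apply: (h u (v * y) a); rewrite E !mulgA. Qed.

Lemma squarefreeMr x y : squarefree (x * y) -> squarefree y.
Proof. by move=> h u v a E; apply: (h (x * u) v a); rewrite E !mulgA. Qed.

Lemma squarefree_gen a : squarefree (gen a).
Proof.
by move=> u v b /(congr1 (@len _ l)); rewrite !lenM !len_gen !addnS addSn => /eqP.
Qed.

Lemma squarefree_mirror x : squarefree x -> squarefree (mirror x).
Proof.
move=> h u v a /(congr1 (@mirror _ l)).
by rewrite (mirrorK Hl) !(mirrorM Hl) !(mirror_gen Hl) !mulgA; apply: h.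
Qed.

Lemma squarefree_last x a : squarefree (x * gen a) -> ~ leR (gen a) x.
Proof. by move=> h [z E]; apply: (h z 1 a); rewrite mulg1 E. Qed.

Definition init_pos : Sigma -> R := fun=> 1%re.
Definition pos x := play l init_pos (word x).
Definition reduced x := legal l init_pos (word x).

Lemma pos_class (w : seq Sigma) : pos (cl w) = play l init_pos w.
Proof. by have [] := cong_play Hl (word_class l w) init_pos. Qed.

Lemma reduced_class (w : seq Sigma) : reduced (cl w) <-> legal l init_pos w.
Proof. by have [_] := cong_play Hl (word_class l w) init_pos. Qed.

Lemma posM x (w : seq Sigma) : pos (x * cl w) = play l (pos x) w.
Proof. by rewrite -[in LHS](wordK x) -class_cat pos_class play_cat. Qed.

Lemma reducedM x (w : seq Sigma) : reduced (x * cl w) <-> reduced x /\ legal l (pos x) w.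
Proof. by rewrite -{1}(wordK x) -class_cat reduced_class legal_cat. Qed.

Lemma pos_gen x a : pos (x * gen a) = fire l (pos x) a.
Proof. exact: posM. Qed.

Lemma reduced_gen x a : reduced (x * gen a) <-> reduced x /\ (0 < pos x a)%re.
Proof. by rewrite reducedM /=; tauto. Qed.

(** Strip from the right the letters s and t as long as possible.  What is
    stripped alternates, otherwise a letter is repeated, and is not longer than
    the label, otherwise one braid move creates a repetition. *)
Lemma dihedral_tail x s t : s != t -> squarefree x ->
  exists (u : A) a b k, [/\ x = u * cl (altword a b k), ~ leR (gen s) u,
    ~ leR (gen t) u, (a = s /\ b = t) \/ (a = t /\ b = s) &
    within (l s t) k].
Proof.
move=> st; have [n] := ubnP (len x); elim: n x => // n IH x xn xQ.
case: (pselect (leR (gen s) x \/ leR (gen t) x)); last first.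
  move=> h; exists x, s, t, 0; split; last by case: (l s t).
  - by rewrite /= class_nil mulg1.
  - by move=> sx; apply: h; left.
  - by move=> tx; apply: h; right.
  - by left.
move=> h.
have [e [y [Ex es]]] : exists e y, x = y * gen e /\ (e = s \/ e = t).
  by case: h => [] [y ->]; [exists s, y|exists t, y]; auto.
have yn : len y < n by move: xn; rewrite Ex lenM len_gen addn1.
have yQ : squarefree y by apply: (@squarefreeMl _ (gen e)); rewrite -Ex.
have [u [a [b [k [Ey us ut abst wk]]]]] := IH y yn yQ.
have ab : a != b by case: abst => [] [-> ->]; rewrite // eq_sym.
have lab : l a b = l s t by case: abst => [] [-> ->]; rewrite // (label_sym Hl).
have w1 : within (l s t) 1.
  by case E: (l s t) => [n'|] //; apply: ltnW; apply: label_gt1 E.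
have [ee|ne] := eqVneq e (if odd k then b else a).
  have {}Ex : x = u * cl (altword a b k.+1).
    by rewrite Ex Ey altwordSr class_rcons -ee mulgA.
  exists u, a, b, k.+1; split=> //; rewrite -lab in wk *.
  case E: (l a b) wk => [m|] //= ; rewrite leq_eqVlt => /orP[/eqP km|//].
  exfalso; rewrite km in Ex.
  have ba : b != a by rewrite eq_sym.
  have lba : l b a = Some m by rewrite (label_sym Hl).
  (* The alternating word of length m + 1 is a followed by a braid word, which
     may be rewritten to begin with a. *)
  apply: (xQ u (cl (altword b a m.-1)) a); rewrite Ex /= class_cons (braid ba lba).
  have := label_gt1 Hl E; case: {E lba Ex km} m => // m _.
  by rewrite /= class_cons !mulgA.
case: k Ey wk ne => [|k] Ey wk ne.
  exists u, b, a, 1%N; split=> //; last by case: abst => [] [-> ->]; auto.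
  rewrite Ex Ey /= class_nil mulg1; congr (_ * gen _).
  by case: abst es ne => [] [-> ->] [] -> //=; rewrite eqxx.
exfalso; apply: (xQ (u * cl (altword a b k)) 1 e).
rewrite mulg1 Ex Ey altwordSr class_rcons !mulgA; congr (_ * gen _ * _).
by case: abst es ne => [] [-> ->] [] -> //=; case: (odd k); rewrite /= ?eqxx.
Qed.

Lemma altword_ends a b n : a != b -> l a b = Some n ->
  leR (gen a) (cl (altword a b n)) /\ leR (gen b) (cl (altword a b n)).
Proof.
move=> ab lab; have E c d : leR (gen (if odd n then c else d)) (cl (altword c d n)).
  have := label_gt1 Hl lab; case: (n) => [//|m] _.
  by rewrite altwordSr class_rcons if_neg; apply: leR_mull.
have Ea := E a b; have := E b a; rewrite -(braid ab lab) => Eb.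
by move: Ea Eb; case: (odd n).
Qed.

Lemma leR_mul x y z : leR x y -> leR x (z * y).
Proof. by move=> [u ->]; rewrite mulgA; apply: leR_mull. Qed.

(** The dichotomy between positive and negative roots.  After the dihedral tail
    is removed, the numbers at s and t are positive by induction; the game on
    these two letters then gives a positive number at s, because x does not end
    with s and the tail is therefore not of full length. *)
Lemma pos_gt0 x s : squarefree x -> ~ leR (gen s) x -> (0 < pos x s)%re.
Proof.
have [n] := ubnP (len x); elim: n x s => // n IH x s xn xQ nsx.
have [-> | x1] := pselect (x = 1); first by rewrite pos_class /init_pos /=; lra.
have [y [t Ex]] := split_last x1.
have st : s != t.
  by apply/eqP => E; apply: nsx; rewrite Ex E; apply: leR_mull.
have [u [a [b [k [Eu us ut abst wk]]]]] := dihedral_tail st xQ.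
have k0 : 0 < k.
  case: k Eu wk => // Eu _; case: ut.
  by move: Eu; rewrite /= class_nil mulg1 => <-; rewrite Ex; apply: leR_mull.
have un : len u < n.
  move: xn; rewrite Eu lenM len_class size_altword ltnS; apply: leq_trans.
  by rewrite -addn1 leq_add2l.
have uQ : squarefree u by apply: (@squarefreeMl _ (cl (altword a b k))); rewrite -Eu.
have ps := IH u s un uQ us; have pt := IH u t un uQ ut.
have ab : a != b by case: abst => [] [-> ->]; rewrite // eq_sym.
have lab : l a b = l s t by case: abst => [] [-> ->]; rewrite // (label_sym Hl).
have pa : (0 < pos u a)%re by case: abst => [] [-> _].
have pb : (0 < pos u b)%re by case: abst => [] [_ ->].
have kn : within (l a b) k.+1.
  case E: (l a b) wk => [m|] //; rewrite -lab E /= leq_eqVlt => /orP[/eqP km|//].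
  case: nsx; rewrite Eu km; apply: leR_mul; have [] := altword_ends ab E.
  by case: abst => [] [-> ->].
have := dihedral_pos Hl ab pa pb kn.
rewrite -play_altword_next // -posM -Eu.
suff -> : s = if odd k then b else a by [].
apply/eqP; apply: contraPT Eu => sk Eu; case: nsx.
rewrite Eu; apply: leR_mul; case: k sk {Eu wk kn} k0 => // k sk _.
rewrite altwordSr class_rcons.
have -> : (if odd k then b else a) = s; last exact: leR_mull.
by move: sk; case: abst => [] [-> ->] /=; case: (odd k); rewrite /= ?eqxx.
Qed.

(** Firing a twice in a row is illegal, as the first firing makes the number at
    a negative; conversely a squarefree element does not end with the letter that
    extends it, so [pos_gt0] makes the extension legal. *)
Lemma reducedP x : squarefree x <-> reduced x.
Proof.
split.
  have [n] := ubnP (len x); elim: n x => // n IH x xn xQ.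
  have [-> | x1] := pselect (x = 1); first by apply/reduced_class.
  have [y [t Ex]] := split_last x1; rewrite Ex in xn xQ *.
  apply/reduced_gen; split.
    apply: IH; last exact: squarefreeMl xQ.
    by move: xn; rewrite lenM len_gen addn1.
  apply: pos_gt0; [exact: squarefreeMl xQ | exact: squarefree_last].
move=> xr u v a E; move: xr; rewrite E -(wordK v).
case/reducedM=> /reduced_gen[/reduced_gen[_ pa]].
by rewrite pos_gen fire_self; lra.
Qed.

Lemma exchange x s : squarefree x -> ~ leR (gen s) x -> squarefree (x * gen s).
Proof.
move=> xQ nsx; apply/reducedP/reduced_gen; split.
  exact/reducedP.
exact: pos_gt0.
Qed.

Lemma squarefree_pos x s : squarefree (x * gen s) -> (0 < pos x s)%re.
Proof. by move/reducedP/reduced_gen => []. Qed.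

(** By [reducedP] only the numbers at s and t after g matter, and these are
    positive. *)
Lemma squarefree_braid g s t n : s != t -> l s t = Some n ->
  squarefree (g * gen s) -> squarefree (g * gen t) ->
  squarefree (g * cl (altword s t n)).
Proof.
move=> st lst gs gt; apply/reducedP/reducedM; split.
  by apply/reducedP; apply: squarefreeMl gs.
by apply: legal_altword_pos; rewrite ?lst //=; apply: squarefree_pos.
Qed.

Lemma pos_last_lt0 x s : squarefree (x * gen s) -> (pos (x * gen s)%g s < 0)%re.
Proof. by move/squarefree_pos; rewrite pos_gen fire_self; lra. Qed.

(** The last letters of a squarefree element are the sites with negative numbers,
    so they can be read off from its position and stripped one by one. *)
Lemma squarefree_pos_inj x y :
  squarefree x -> squarefree y -> pos x = pos y -> x = y.
Proof.
have [n] := ubnP (len x); elim: n x y => // n IH x y xn xQ yQ E.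
have [x1 | /split_last[x' [s Ex]]] := pselect (x = 1).
  have [-> // | /split_last[z [s Ey]]] := pselect (y = 1).
  rewrite Ey in yQ; have := pos_last_lt0 yQ.
  by rewrite -Ey -E x1 pos_class /= /init_pos; lra.
have xs : (pos x s < 0)%re by rewrite Ex; apply: pos_last_lt0; rewrite -Ex.
have [y' Ey] : leR (gen s) y.
  apply: contrapT => nsy; have := pos_gt0 yQ nsy; rewrite -E; lra.
rewrite Ex Ey; congr (_ * _); rewrite {}Ex in xn xQ E; rewrite {}Ey in yQ E.
apply: IH (squarefreeMl xQ) (squarefreeMl yQ) _.
  by move: xn; rewrite lenM len_gen // addn1.
by move: E; rewrite !pos_gen => /(congr1 (fire l ^~ s)); rewrite !fireK.
Qed.

Lemma squarefree_mulIg s x y :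
  squarefree (x * gen s) -> x * gen s = y * gen s -> x = y.
Proof.
move=> xs E; apply: squarefree_pos_inj; [exact: squarefreeMl xs| |].
  by rewrite E in xs; apply: squarefreeMl xs.
by move: (congr1 pos E); rewrite !pos_gen => /(congr1 (fire l ^~ s));
  rewrite !fireK.
Qed.

Lemma squarefree_mulgI s x y :
  squarefree (gen s * x) -> gen s * x = gen s * y -> x = y.
Proof.
move=> sx E; apply: (can_inj (mirrorK Hl)).
apply: (@squarefree_mulIg s); rewrite -[gen s](mirror_gen Hl) -!(mirrorM Hl).
  exact: squarefree_mirror.
by rewrite E.
Qed.

(** If the dihedral tail of x were shorter than the label, the letter continuing
    the alternation would have a positive number, but the last letters of x have
    negative ones. *)
Lemma squarefree_common_right x s t : s != t -> squarefree x ->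
  leR (gen s) x -> leR (gen t) x ->
  exists2 n, l s t = Some n & leR (cl (altword s t n)) x.
Proof.
move=> st xQ sx tx.
have neg c : leR (gen c) x -> (pos x c < 0)%re.
  by move=> [y Ey]; rewrite Ey; apply: pos_last_lt0; rewrite -Ey.
have [u [a [b [k [Eu us ut abst wk]]]]] := dihedral_tail st xQ.
have ab : a != b by case: abst => [] [-> ->]; rewrite // eq_sym.
have lab : l a b = l s t by case: abst => [] [-> ->]; rewrite // (label_sym Hl).
have uQ : squarefree u by apply: (@squarefreeMl _ (cl (altword a b k))); rewrite -Eu.
have ps := pos_gt0 uQ us; have pt := pos_gt0 uQ ut.
have pa : (0 < pos u a)%re by case: abst => [] [-> _].
have pb : (0 < pos u b)%re by case: abst => [] [_ ->].
have [kn | nkn] := pselect (within (l a b) k.+1).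
  have := dihedral_pos Hl ab pa pb kn.
  rewrite -(play_altword_next Hl) // -posM -Eu.
  have := neg _ sx; have := neg _ tx.
  by case: abst => [] [-> ->]; case: (odd k); lra.
case E: (l a b) nkn => [m|] // /negP; rewrite /= -leqNgt => mk.
exists m; first by rewrite -lab.
have {mk wk} mk : k = m.
  by apply/eqP; rewrite eqn_leq mk andbT; move: wk; rewrite -lab E.
rewrite Eu mk; case: abst => [] [<- <-]; first exact: leR_mull.
by rewrite -(braid ab E); apply: leR_mull.
Qed.

Lemma squarefree_common_left x s t : s != t -> squarefree x ->
  leL (gen s) x -> leL (gen t) x ->
  exists2 n, l s t = Some n & leL (cl (altword s t n)) x.
Proof.
move=> st xQ /(leL_mirror Hl) sx /(leL_mirror Hl) tx.
rewrite !(mirror_gen Hl) in sx tx.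
have [n lst [z Ez]] := squarefree_common_right st (squarefree_mirror xQ) sx tx.
exists n => //; exists (mirror z); rewrite -[LHS](mirrorK Hl) Ez (mirrorM Hl).
congr (_ * _); rewrite (mirror_class Hl) rev_altword; case: (odd n) => //.
by rewrite (braid st lst).
Qed.

(** * The reduction lemma and least common multiples *)

(** The conclusion of the reduction lemma for the equality a x = b y. *)
Definition same_or_cross a x b y := (a = b /\ x = y) \/
  exists n z, [/\ a != b, l a b = Some n,
    x = cl (altword b a n.-1) * z & y = cl (altword a b n.-1) * z].

Definition reduction_upto N := forall a b x y,
  len x < N -> gen a * x = gen b * y -> same_or_cross a x b y.

Lemma altword_head a b n : l a b = Some n ->
  cl (altword a b n) = gen a * cl (altword b a n.-1).
Proof. by move/(label_gt1 Hl); case: n => // n _; rewrite -class_cons. Qed.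

Section Bounded.
Variable N : nat.
Hypothesis HN : reduction_upto N.

Lemma cancel_upto g x y : len (g * x) <= N -> g * x = g * y -> x = y.
Proof.
have [n] := ubnP (len g); elim: n g => // n IH g gn gx.
have [-> | /split_head[a [h Eg]]] := pselect (g = 1); first by rewrite !mul1g.
rewrite {}Eg -!mulgA in gn gx *; rewrite lenM // len_gen // add1n in gn.
rewrite lenM // len_gen // add1n in gx.
move=> E; apply: (IH h) => //; first by apply: ltnW.
by have [[_]|[? [? [/eqP]]]] := HN gx E.
Qed.

Lemma leL_cancel_upto g x y : len (g * y) <= N -> leL (g * x) (g * y) -> leL x y.
Proof.
move=> gy [z E]; rewrite -mulgA in E; rewrite (cancel_upto gy E).
exact: leL_mulr.
Qed.

(** The property P is carried along from the left factor g: a condition that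
    passes to left factors and is stable under braid words is stable under least
    upper bounds.  It will be squarefreeness, support in I, or the trivial one.
    The induction replaces two elements x = s x' and y = t y' by the least upper
    bounds of x' and y' with the complements of s and t, then joins what these
    contribute beyond the braid word of s and t. *)
Lemma lcm_upto (P : A -> Prop)
    (Ppre : forall x y, P (x * y) -> P x)
    (Ploc : forall g s t n, s != t -> l s t = Some n ->
       P (g * gen s) -> P (g * gen t) -> P (g * cl (altword s t n)))
    z g x y :
  len z <= N -> leL x z -> leL y z -> P (g * x) -> P (g * y) ->
  exists m, [/\ leL x m, leL y m, P (g * m) &
    forall w, len w <= N -> leL x w -> leL y w -> leL m w].
Proof.
have [n] := ubnP (len z); elim: n z g x y => // n IH z g x y zn zN xz yz gx gy.
have [x1 | /split_head[s [x' Ex]]] := pselect (x = 1).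
  by exists y; split=> //; [rewrite x1; apply: leL_1 | apply: leL_refl].
have [y1 | /split_head[t [y' Ey]]] := pselect (y = 1).
  by exists x; split=> //; [apply: leL_refl | rewrite y1; apply: leL_1].
have tail c u w : leL (gen c * u) w ->
    exists w', [/\ w = gen c * w', len w' < len w & leL u w'].
  move=> [v Ew]; exists (u * v); split; rewrite ?Ew ?mulgA //.
    by rewrite -mulgA [X in _ < X]lenM // len_gen.
  exact: leL_mulr.
rewrite {}Ex in gx xz *; rewrite {}Ey in gy yz *.
have [z1 [Ez1 z1z xz1]] := tail _ _ _ xz.
have [z2 [Ez2 z2z yz2]] := tail _ _ _ yz.
have z1n : len z1 < n by apply: leq_trans z1z zn.
have z2n : len z2 < n by apply: leq_trans z2z zn.
have z1N : len z1 < N by apply: leq_trans z1z zN.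
have z2N : len z2 < N by apply: leq_trans z2z zN.
have Ez : gen s * z1 = gen t * z2 by rewrite -Ez1.
rewrite !mulgA in gx gy.
have [[st E12] | [k [z3 [st lst E1 E2]]]] := HN z1N Ez.
  rewrite -{t}st in gy yz Ez2 Ez *; rewrite -E12 in yz2.
  have [m [xm ym gm mleast]] := IH _ _ _ _ z1n (ltnW z1N) xz1 yz2 gx gy.
  exists (gen s * m); split; try exact: leL_mul2; first by rewrite mulgA.
  move=> w wN /tail[w' [Ew ww' xw]] yw; rewrite Ew in wN yw *.
  apply/leL_mul2/mleast => //; last exact: leL_cancel_upto yw.
  by apply: leq_trans wN; rewrite lenM // leq_addl.
move: (altword_head lst) => Es.
have lts : l t s = Some k by rewrite (label_sym Hl).
move: (altword_head lts); rewrite -(braid st lst) => Et.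
move: E1 E2 Es Et; set p := cl _; set q := cl (altword s t k.-1); set d := cl _.
move=> E1 E2 Es Et.
have gd : P (g * d) by apply: Ploc => //; [apply: Ppre gx | apply: Ppre gy].
have pz1 : leL p z1 by rewrite E1; apply: leL_mulr.
have qz2 : leL q z2 by rewrite E2; apply: leL_mulr.
have gp : P (g * gen s * p) by rewrite -mulgA -Es.
have gq : P (g * gen t * q) by rewrite -mulgA -Et.
(* Up to the first letters s and t, these are the least upper bounds of x and
   the braid word d, then of y and d. *)
have [m1 [xm1 [p' Ep] gm1 m1least]] := IH _ _ _ _ z1n (ltnW z1N) xz1 pz1 gx gp.
have [m2 [ym2 [q' Eq] gm2 m2least]] := IH _ _ _ _ z2n (ltnW z2N) yz2 qz2 gy gq.
rewrite {}Ep in xm1 gm1 m1least; rewrite {}Eq in ym2 gm2 m2least.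
have pz3 : leL p' z3.
  apply: (@leL_cancel_upto p); rewrite -E1; first exact: ltnW.
  by apply: m1least => //; apply: ltnW.
have qz3 : leL q' z3.
  apply: (@leL_cancel_upto q); rewrite -E2; first exact: ltnW.
  by apply: m2least => //; apply: ltnW.
have z3z1 : len z3 <= len z1 by rewrite E1 lenM // leq_addl.
have gdp : P (g * d * p') by rewrite Es !mulgA in gm1 *.
have gdq : P (g * d * q') by rewrite Et !mulgA in gm2 *.
(* Both bounds are multiples of d; only their cofactors p' and q' remain to be
   joined, inside z3. *)
have [m3 [pm3 qm3 gm3 m3least]] := IH _ _ _ _ (leq_ltn_trans z3z1 z1n)
  (leq_trans z3z1 (ltnW z1N)) pz3 qz3 gdp gdq.
exists (d * m3); split; last 2 first.
- by rewrite mulgA.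
- move=> w wN /tail[w1 [Ew1 w1w xw1]] /tail[w2 [Ew2 w2w yw2]].
  have w1N := leq_trans w1w wN; have w2N := leq_trans w2w wN.
  have Ew : gen s * w1 = gen t * w2 by rewrite -Ew1.
  have [[/eqP] | [k' [w3 [_ lst' F1 F2]]]] := HN w1N Ew.
    by rewrite (negbTE st).
  move: lst' F1 F2; rewrite lst => -[<-] F1 F2.
  rewrite Ew1 F1 mulgA -Es; apply: leL_mul2.
  have w3w1 : len w3 <= len w1 by rewrite F1 lenM // leq_addl.
  apply: m3least; first exact: leq_trans w3w1 (ltnW w1N).
    apply: (@leL_cancel_upto p); rewrite -F1; first exact: ltnW.
    by apply: m1least; [apply: ltnW | | rewrite F1; apply: leL_mulr].
  apply: (@leL_cancel_upto q); rewrite -F2; first exact: ltnW.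
  by apply: m2least; [apply: ltnW | | rewrite F2; apply: leL_mulr].
- rewrite Es -mulgA; apply/leL_mul2/(leL_trans xm1); exact: leL_mul2.
- rewrite Et -mulgA; apply/leL_mul2/(leL_trans ym2); exact: leL_mul2.
Qed.

End Bounded.

Lemma squarefree_altword s t n : s != t -> l s t = Some n ->
  squarefree (cl (altword s t n)).
Proof.
move=> st lst; rewrite -[cl _]mul1g; apply: squarefree_braid => //.
  by rewrite mul1g; apply: squarefree_gen.
by rewrite mul1g; apply: squarefree_gen.
Qed.

Lemma same_or_cross_sym a x b y :
  same_or_cross a x b y -> same_or_cross b y a x.
Proof.
case=> [[-> ->]|[n [z [ab lab Ex Ey]]]]; first by left.
by right; exists n, z; split=> //; rewrite 1?eq_sym // (label_sym Hl).
Qed.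

(** The heart of the reduction lemma.  For three distinct letters, z is a common
    multiple of the complements u1 and u2 of a and b after c.  Their least upper
    bound m is such that c m is squarefree, and c m begins with both a and b, so
    the reduction lemma for squarefree elements applies to it; the cofactor z' of
    m in z is carried along. *)
Lemma same_or_cross_trans N c z a x b y : reduction_upto N -> len z <= N ->
  same_or_cross a x c z -> same_or_cross c z b y -> same_or_cross a x b y.
Proof.
move=> HN zN [[-> ->] //|[p [w1 [ac lac Ex Ez1]]]].
case=> [[<- <-]|[q [w2 [cb lcb Ez2 Ey]]]]; first by right; exists p, w1.
have [ab | ab] := eqVneq a b.
  left; split=> //; move: lcb Ez2 Ey; rewrite -ab (label_sym Hl) lac => -[<-].
  move=> Ez2 Ey; rewrite Ex Ey; congr (_ * _).
  by apply: (cancel_upto HN (g := cl (altword a c p.-1))); rewrite -Ez1.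
have join d r : d != c -> l d c = Some r ->
    gen c * cl (altword d c r.-1) = gen d * cl (altword c d r.-1)
    /\ squarefree (gen c * cl (altword d c r.-1)).
  move=> dc ldc; have lcd : l c d = Some r by rewrite (label_sym Hl).
  by rewrite -!altword_head // (braid dc ldc); split=> //;
    apply: squarefree_altword; rewrite // eq_sym.
have bc : b != c by rewrite eq_sym.
have lbc : l b c = Some q by rewrite (label_sym Hl).
have [Ec1 Q1] := join _ _ ac lac; have [Ec2 Q2] := join _ _ bc lbc.
move: Ez1 Ez2 Ex Ey Ec1 Q1 Ec2 Q2 {join}.
set u1 := cl _; set u2 := cl _; set v1 := cl _; set v2 := cl _.
move=> Ez1 Ez2 Ex Ey Ec1 Q1 Ec2 Q2.
have u1z : leL u1 z by rewrite Ez1; apply: leL_mulr.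
have u2z : leL u2 z by rewrite Ez2; apply: leL_mulr.
have [m [[m1 Em1] [m2 Em2] cmQ mz]] := lcm_upto HN (@squarefreeMl)
  squarefree_braid zN u1z u2z Q1 Q2.
have [z' Ez'] := mz _ zN u1z u2z.
have Ew1 : w1 = m1 * z'.
  by apply: (cancel_upto HN (g := u1)); rewrite -Ez1 // Ez' Em1 mulgA.
have Ew2 : w2 = m2 * z'.
  by apply: (cancel_upto HN (g := u2)); rewrite -Ez2 // Ez' Em2 mulgA.
have Ea : gen c * m = gen a * (v1 * m1) by rewrite Em1 mulgA Ec1 -mulgA.
have Eb : gen c * m = gen b * (v2 * m2) by rewrite Em2 mulgA Ec2 -mulgA.
have am : leL (gen a) (gen c * m) by rewrite Ea; apply: leL_mulr.
have bm : leL (gen b) (gen c * m) by rewrite Eb; apply: leL_mulr.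
have [n lab [h Eh]] := squarefree_common_left ab cmQ am bm.
right; exists n, (h * z'); split=> //.
  rewrite Ex Ew1 !mulgA; congr (_ * _); apply: (squarefree_mulgI (s := a)).
    by rewrite -Ea.
  by rewrite -Ea Eh (altword_head lab) mulgA.
have lba : l b a = Some n by rewrite (label_sym Hl).
rewrite Ey Ew2 !mulgA; congr (_ * _); apply: (squarefree_mulgI (s := b)).
  by rewrite -Eb.
by rewrite -Eb Eh (braid ab lab) (altword_head lba) mulgA.
Qed.

Definition heads_cross (u v : seq Sigma) := match u, v with
  | [::], [::] => True
  | a :: u', b :: v' => same_or_cross a (cl u') b (cl v')
  | _, _ => False
  end.

(** All cases of the congruence are immediate except transitivity, where the
    cancellation of the middle word involves only elements of length at most N. *)
Lemma heads_cross_cong N u v : reduction_upto N ->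
  at_cong l u v -> size u <= N.+1 -> heads_cross u v.
Proof.
move=> HN; elim=> {u v} [a b n ab lab|[|a u]|u v uv IH|u v w uv IH1 vw IH2
  |u u' v v' uu' IH1 vv' IH2] // uN.
- have n1 := label_gt1 Hl lab; case: n n1 lab {uN} => // n _ lab /=; right.
  by exists n.+1, 1; rewrite !mulg1.
- by left.
- rewrite (cong_size uv) in IH; case: u v {uv uN IH} (IH uN) => [|a u] [|b v] //.
  exact: same_or_cross_sym.
- rewrite -(cong_size uv) in IH2; move: (IH1 uN) (IH2 uN).
  have vN : size v <= N.+1 by rewrite -(cong_size uv).
  case: u v w vN {uv vw IH1 IH2 uN} => [|a u] [|c v] [|b w] // vN.
  by apply: same_or_cross_trans HN _; rewrite len_class.
- have su := cong_size uu'; have uN' : size u <= N.+1.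
    by apply: leq_trans uN; rewrite size_cat leq_addr.
  case: u u' su {uu' IH1 uN'} (IH1 uN') uN => [|a u] [|b u'] // _.
  have Ev : cl v = cl v' by apply/at_classP.
  move=> [[-> E]|[n [z [ab lab Eu Eu']]]] _ /=.
    by left; rewrite !class_cat E Ev.
  right; exists n, (z * cl v); split=> //; first by rewrite class_cat Eu mulgA.
  by rewrite class_cat Eu' Ev mulgA.
Qed.

Theorem reduction a b x y : gen a * x = gen b * y -> same_or_cross a x b y.
Proof.
suff H N : reduction_upto N by apply: (H (len x).+1).
elim: N => // N IH {}a {}b {}x {}y xN E.
have : at_cong l (a :: word x) (b :: word y).
  by apply/at_classP; rewrite !class_cons !wordK.
by move/(heads_cross_cong IH) => /(_ xN) /=; rewrite !wordK.
Qed.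

Lemma reductionN N : reduction_upto N.
Proof. by move=> a b x y _; apply: reduction. Qed.

Lemma mul_cancel g x y : g * x = g * y -> x = y.
Proof. exact: (cancel_upto (@reductionN (len (g * x))) (leqnn _)). Qed.

Lemma leL_cancel g x y : leL (g * x) (g * y) -> leL x y.
Proof. by move=> [z]; rewrite -mulgA => /mul_cancel ->; apply: leL_mulr. Qed.

Lemma common_left x s t : s != t -> leL (gen s) x -> leL (gen t) x ->
  exists2 n, l s t = Some n & leL (cl (altword s t n)) x.
Proof.
move=> st [y Es] [z Et]; rewrite Es in Et.
have [[/eqP]|[n [w [_ lst Ey _]]]] := reduction Et; first by rewrite (negbTE st).
by exists n => //; rewrite Es Ey mulgA -(altword_head lst); apply: leL_mulr.
Qed.

(** The bound is least among all common multiples: compare it with the one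
    obtained for a larger bound on the length. *)
Lemma lcm_exists (P : A -> Prop)
    (Ppre : forall x y, P (x * y) -> P x)
    (Ploc : forall g s t n, s != t -> l s t = Some n ->
       P (g * gen s) -> P (g * gen t) -> P (g * cl (altword s t n)))
    z g x y :
  leL x z -> leL y z -> P (g * x) -> P (g * y) ->
  exists m, [/\ leL x m, leL y m, P (g * m) &
    forall w, leL x w -> leL y w -> leL m w].
Proof.
move=> xz yz gx gy.
have [m [xm ym gm mleast]] := lcm_upto (@reductionN _) Ppre Ploc
  (leqnn (len z)) xz yz gx gy.
exists m; split=> // w xw yw.
have [m' [xm' ym' _ m'least]] := lcm_upto (@reductionN _) Ppre Ploc
  (leq_maxl (len z) (len w)) xz yz gx gy.
suff -> : m = m' by apply: m'least; rewrite // leq_maxr.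
have zmax : len z <= maxn (len z) (len w) by apply: leq_maxl.
have m'z := m'least z zmax xz yz.
apply: leL_anti; first by apply: mleast => //; apply: leL_len.
by apply: m'least => //; apply: leq_trans zmax; apply/leL_len/mleast.
Qed.

(** * The smallest Garside subset *)

Lemma is_lub_pair x y m : is_lub [set x; y]%classic m <->
  [/\ leL x m, leL y m & forall w, leL x w -> leL y w -> leL m w].
Proof.
split=> [[up least]|[xm ym least]].
  by split=> [| |w xw yw]; [apply: up; left|apply: up; right|
    apply: least => _ [->|->]].
split=> [_ [->|->] //|w h]; apply: least; apply: h; [by left|by right].
Qed.

Lemma squarefree_garside : garside_subset l squarefree.
Proof.
split=> [_ [a _ <-]|x y m xQ yQ /is_lub_pair [xm ym least]|x y yQ [z Ey]].
- exact: squarefree_gen.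
- have Qx : squarefree (1 * x) by rewrite mul1g.
  have Qy : squarefree (1 * y) by rewrite mul1g.
  have [m' [xm' ym' mQ least']] := lcm_exists (@squarefreeMl)
    squarefree_braid xm ym Qx Qy.
  suff -> : m = m' by rewrite mul1g in mQ.
  by apply: leL_anti => //; [apply: least | apply: least'].
- by apply: (@squarefreeMr z); rewrite -Ey.
Qed.

Lemma garside_squarefree x : S x -> squarefree x.
Proof. by apply; apply: squarefree_garside. Qed.

Lemma garside_gen a : S (gen a).
Proof. by have [[h _ _] _] := smallest_garsideP l; apply: h; exists a. Qed.

Lemma garside_suffix x y : S (x * y) -> S y.
Proof. by have [[_ _ h] _] := smallest_garsideP l => /h; apply; exists x. Qed.

Lemma garside_one : S 1.
Proof.
have [/card_gt0P[a _] _ _] := Hl.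
by apply: (@garside_suffix (gen a)); rewrite mulg1; apply: garside_gen.
Qed.

(** S and P are both closed under least upper bounds; one and the same bound has
    to serve for both. *)
Lemma garside_lcm (P : A -> Prop)
    (Ppre : forall x y, P (x * y) -> P x)
    (Ploc : forall g s t n, s != t -> l s t = Some n ->
       P (g * gen s) -> P (g * gen t) -> P (g * cl (altword s t n))) x y z :
  leL x z -> leL y z -> S x -> S y -> P x -> P y ->
  exists m, [/\ leL x m, leL y m, S m, P m &
    forall w, leL x w -> leL y w -> leL m w].
Proof.
rewrite -{1}[x]mul1g -{1}[y]mul1g => xz yz Sx Sy Px Py.
rewrite -[x]mul1g in Px; rewrite -[y]mul1g in Py; rewrite !mul1g in xz yz.
have [m [xm ym mP least]] := lcm_exists Ppre Ploc xz yz Px Py.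
rewrite mul1g in mP; exists m; split=> //.
have [[_ h _] _] := smallest_garsideP l; apply: (h x y) => //.
exact/is_lub_pair.
Qed.

(** * Garside elements of parabolic submonoids *)

(** The counterpart of the fact that an element of a Coxeter group all of whose
    simple reflections are descents is the longest one.  Write x = x' s and strip
    from x' its dihedral tail for s and its last letter t: u s and u t are
    shorter than x, so they divide w by induction, hence so does u followed by the
    braid word of s and t, of which x is a left divisor. *)
Lemma squarefree_dominated I x w : squarefree x -> supported I x ->
  (forall s, s \in I -> leL (gen s) w) -> leL x w.
Proof.
move=> + + wI; have [n] := ubnP (len x); elim: n x => // n IH x xn xQ xI.
have [-> | /split_last[x' [s Ex]]] := pselect (x = 1); first exact: leL_1.
rewrite {}Ex in xn xQ xI *.
move: xI; rewrite supportedM // supported_gen // => /andP[x'I sI].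
have [-> | /split_last[x2 [t Ex']]] := pselect (x' = 1).
  by rewrite mul1g; apply: wI.
have tI : t \in I by move: x'I; rewrite Ex' supportedM // supported_gen // => /andP[].
have nsx' := squarefree_last xQ; have x'Q := squarefreeMl xQ.
have tx' : leR (gen t) x' by rewrite Ex'; apply: leR_mull.
have st : s != t by apply/eqP => st; apply: nsx'; rewrite st.
have [u [a [b [k [Eu us ut abst wk]]]]] := dihedral_tail st x'Q.
have ab : a != b by case: abst => [] [-> ->]; rewrite // eq_sym.
have lab : l a b = l s t by case: abst => [] [-> ->]; rewrite // (label_sym Hl).
have k0 : 0 < k.
  by case: k Eu {wk} => // Eu; case: ut; move: tx'; rewrite Eu /= class_nil mulg1.
have uQ : squarefree u by apply: (@squarefreeMl _ (cl (altword a b k))); rewrite -Eu.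
have un : (len u).+1 < n.
  move: xn; rewrite lenM // len_gen // addn1 ltnS; apply: leq_trans.
  by rewrite Eu lenM // len_class // size_altword ltnS -addn1 leq_add2l.
have uI : supported I u by move: x'I; rewrite Eu supportedM // => /andP[].
have low c : c \in I -> ~ leR (gen c) u -> leL (u * gen c) w.
  move=> cI ncu; apply: IH; first by rewrite lenM // len_gen // addn1.
    exact: exchange.
  by rewrite supportedM // uI supported_gen.
have [w1 Ew] : leL u w by apply: leL_trans (low s sI us); apply: leL_mulr.
have sw1 : leL (gen s) w1 by apply: (leL_cancel (g := u)); rewrite -Ew; apply: low.
have tw1 : leL (gen t) w1 by apply: (leL_cancel (g := u)); rewrite -Ew; apply: low.
have aw1 : leL (gen a) w1 by case: abst => [] [-> _].
have bw1 : leL (gen b) w1 by case: abst => [] [_ ->].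
have [m labm altw1] := common_left ab aw1 bw1.
have sab : s = (if odd k then b else a).
  case: k Eu {wk} k0 => // k Eu _; apply: contrapT => ns; apply: nsx'.
  rewrite Eu altwordSr class_rcons mulgA.
  suff <- : s = if odd k then b else a by apply: leR_mull.
  by move: ns; case: abst => [] [-> ->] /=; case: (odd k).
have km : k < m.
  rewrite ltn_neqAle -[k <= m]/(within (Some m) k) -labm lab wk andbT.
  apply/eqP => km; apply: nsx'; rewrite Eu km; apply: leR_mul.
  by have [] := altword_ends ab labm; case: abst => [] [-> ->].
rewrite Ew Eu -mulgA; apply: leL_mul2; apply: leL_trans altw1.
rewrite sab -class_rcons -altwordSr -(subnKC km) altword_add class_cat.
exact: leL_mulr.
Qed.

Definition heads x : {set Sigma} := [set a | `[< leL (gen a) x >]]%SET.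

Lemma headsP a x : reflect (leL (gen a) x) (a \in heads x).
Proof. by rewrite inE; apply: asboolP. Qed.

Lemma heads_eq0 x : (heads x == set0) = `[< x = 1 >].
Proof.
apply/eqP/asboolP => [h|->].
  apply: contrapT => /split_head[a [y Ex]].
  have : a \in heads x by apply/headsP; rewrite Ex; apply: leL_mulr.
  by rewrite h inE.
apply/setP => a; rewrite [in RHS]inE; apply/headsP => /leL_len.
by rewrite len_gen // len1.
Qed.

Lemma supported_braid I g s t n : s != t -> l s t = Some n ->
  supported I (g * gen s) -> supported I (g * gen t) ->
  supported I (g * cl (altword s t n)).
Proof.
move=> _ _; rewrite !supportedM // !supported_gen // => /andP[-> sI] /andP[_ tI].
exact: supported_altword.
Qed.

Lemma delta_exists z : exists D, [/\ S D, supported (heads z) D,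
  forall s, s \in heads z -> leL (gen s) D & leL D z].
Proof.
suff H (r : seq Sigma) : {subset r <= heads z} -> exists D,
    [/\ S D, supported (heads z) D, forall s, s \in r -> leL (gen s) D & leL D z].
  have [s|D [SD ID DI Dz]] := H (enum (heads z)); first by rewrite mem_enum.
  by exists D; split=> // s sz; apply: DI; rewrite mem_enum.
elim: r => [|s r IH] rz.
  exists 1; split=> //; [exact: garside_one | | exact: leL_1].
  by rewrite -class_nil supported_class.
have sz : s \in heads z by apply: rz; rewrite mem_head.
have [|D [SD ID Dr Dz]] := IH.
  by move=> t tr; apply: rz; rewrite inE tr orbT.
have Ppre x y : supported (heads z) (x * y) -> supported (heads z) x.
  by rewrite supportedM // => /andP[].
have [|m [sm Dm Sm Im least]] := garside_lcm Ppre (@supported_braid (heads z))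
  (elimT (headsP _ _) sz) Dz (garside_gen s) SD _ ID.
  by rewrite supported_gen.
exists m; split=> //; last by apply: least => //; apply/headsP.
by move=> t; rewrite inE => /orP[/eqP->//|/Dr tD]; apply: leL_trans Dm.
Qed.

(** Otherwise D s would be squarefree by exchange and supported by I, hence a
    left divisor of D by [squarefree_dominated], which is impossible. *)
Lemma delta_tails I D : S D -> supported I D ->
  (forall s, s \in I -> leL (gen s) D) -> forall s, s \in I -> leR (gen s) D.
Proof.
move=> SD ID DI s sI; apply: contrapT => nsD.
have DQ := exchange (garside_squarefree SD) nsD.
have : leL (D * gen s) D.
  by apply: squarefree_dominated DQ _ DI; rewrite supportedM // ID supported_gen.
by move/leL_len; rewrite lenM // len_gen // addn1 ltnn.
Qed.

(** * Edges and vertices of the Charney graph *)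

(** If z is in S and divides x y, the least upper bound of x and z is in S and of
    the form x w with w dividing y. *)
Lemma normal_step_of x y : S x ->
  (forall w, w <> 1 -> leL w y -> ~ S (x * w)) -> normal_step l x y.
Proof.
move=> Sx h; split=> [z [Sz zxy]|z]; last by apply; split=> //; exact: leL_mulr.
have xy := leL_mulr x y.
have [m [[w Ew] zm Sm _ least]] := @garside_lcm (fun=> True) (fun _ _ _ => I)
  (fun _ _ _ _ _ _ _ _ => I) x z (x * y) xy zxy Sx Sz I I.
have w1 : w = 1.
  apply: contrapT => w1; apply: (h w w1); last by rewrite -Ew.
  by apply: (leL_cancel (g := x)); rewrite -Ew; apply: least.
by move: zm; rewrite Ew w1 mulg1.
Qed.

(** If w begins with a, and x ends with a, then x w is not squarefree. *)
Lemma normal_step_heads x y : S x ->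
  (forall a, a \in heads y -> leR (gen a) x) -> normal_step l x y.
Proof.
move=> Sx h; apply: normal_step_of => // w /split_head[a [w' ->]] awy.
have [|x' Ex] := h a; first by apply/headsP; apply: leL_trans awy; apply: leL_mulr.
by move/garside_squarefree/(_ x' w' a); rewrite Ex mulgA; apply.
Qed.

(** An element of S beginning with all the letters is the Garside element,
    because squarefree elements divide every common multiple of the letters. *)
Lemma charney_vertexP x :
  charney_vertex l x <-> [/\ S x, heads x != set0 & heads x != setT].
Proof.
split=> [[Sx /not_orP[nD n1]]|[Sx h0 hT]].
  split=> //; first by rewrite heads_eq0; apply/asboolP.
  apply/eqP => hT; apply: nD; split=> [_ [a _ <-]|w h].
    by apply/headsP; rewrite hT inE.
  apply: (@squarefree_dominated setT); first exact: garside_squarefree.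
    by apply/allP => a _; rewrite inE.
  by move=> s _; apply: h; exists s.
split=> // [[[up _]|x1]].
  by case/eqP: hT; apply/setP => a; rewrite [RHS]inE; apply/headsP/up; exists a.
by move: h0; rewrite heads_eq0 => /asboolP; apply.
Qed.

Lemma reach_step x y : vertex x -> vertex y -> normal_step l x y -> reach x y.
Proof. by move=> vx vy xy; apply: rt_step. Qed.

(** A first letter a of s x other than s appears through the braid word of a and
    s, of which x takes all but the letter s in front. *)
Lemma heads_gen_mul s x a : a \in heads (gen s * x) -> a != s ->
  exists2 n, l s a = Some n & leL (cl (altword a s n.-1)) x.
Proof.
move=> /headsP ax a_s; have sx := leL_mulr (gen s) x.
have [|n lsa] := common_left _ sx ax; first by rewrite eq_sym.
by rewrite (altword_head lsa) => /leL_cancel; exists n.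
Qed.

Lemma heads_gen s : heads (gen s) = [set s].
Proof.
apply/setP => a; rewrite [RHS]inE; apply/idP/eqP => [|->]; last first.
  by apply/headsP/leL_refl.
rewrite -[gen s]mulg1 => h; apply/eqP; apply: contraT => /(heads_gen_mul h)[n lsa].
move/leL_len; rewrite len_class // size_altword len1.
by have := label_gt1 Hl lsa; case: n {lsa} => [|[]].
Qed.

Section Generators.
Variable v : A.
Hypothesis vv : vertex v.

(** The existence of a vertex excludes a single generator, which would be the
    Garside element. *)
Lemma gen_vertex a : vertex (gen a).
Proof.
have [_ h0 hT] := (charney_vertexP v).1 vv.
apply/charney_vertexP; rewrite heads_gen; split; first exact: garside_gen.
  by apply/set0Pn; exists a; rewrite inE.
apply: contraNneq hT => aT.
have := subsetT (heads v); rewrite -aT subset1 (negbTE h0) orbF => /eqP ->.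
by rewrite eqxx.
Qed.

(** Since s and t do not commute, s is the only first letter of s t, so s -> s t
    -> t if s t is in S.  Otherwise s is the head of s t and s -> t. *)
Lemma reach_neighbor s t : s != t -> l s t <> Some 2 -> reach (gen s) (gen t).
Proof.
move=> st lst; have [Sst | nSst] := pselect (S (gen s * gen t)).
  have hst : heads (gen s * gen t) = [set s].
    apply/setP => a; rewrite [RHS]inE; apply/idP/eqP => [h|->]; last first.
      exact/headsP/leL_mulr.
    apply/eqP; apply: contraT => /(heads_gen_mul h)[n lsa an].
    have := leL_len an; rewrite len_class // size_altword len_gen // => n2.
    have {n2} n2 : n = 2.
      by have := label_gt1 Hl lsa; case: n n2 {lsa an} => [|[|[]]].
    have : a \in heads (gen t) by apply/headsP; rewrite n2 in an.
    by rewrite heads_gen inE => /eqP at_; case: lst; rewrite -at_ lsa n2.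
  have vst : vertex (gen s * gen t).
    have [_ h0 hT] := (charney_vertexP _).1 (gen_vertex s).
    by apply/charney_vertexP; rewrite hst -heads_gen.
  apply: (rt_trans _ _ _ (gen s * gen t)); apply: reach_step => //;
    try exact: gen_vertex; apply: normal_step_heads => //.
  - exact: garside_gen.
  - by move=> a; rewrite hst inE => /eqP ->; exists 1; rewrite mul1g.
  - by move=> a; rewrite heads_gen inE => /eqP ->; apply: leR_mull.
apply: reach_step; try exact: gen_vertex; apply: normal_step_of => //.
  exact: garside_gen.
move=> w /split_head[a [w' ->]] /leL_len_eq ->//.
by rewrite lenM // !len_gen.
Qed.

Hypothesis irr : at_irreducible A.

Lemma reach_gens a b : reach (gen a) (gen b).
Proof.
pose J := [set c | `[< reach (gen a) (gen c) >]]%SET.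
have [JT | JT] := eqVneq J setT.
  have : b \in J by rewrite JT inE.
  by rewrite inE => /asboolP.
have J0 : J != set0.
  by apply/set0Pn; exists a; rewrite inE; apply/asboolP/rt_refl.
have [s [t [sJ tJ lst]]] := irreducible_cut Hl irr J0 JT.
case/negP: (sJ); rewrite inE; apply/asboolP; move: (tJ); rewrite inE => /asboolP at_.
apply: rt_trans at_ _; apply: reach_neighbor; last by rewrite (label_sym Hl).
by apply: contraNneq sJ => <-.
Qed.

End Generators.

Lemma reach_last x : vertex x -> exists a, reach x (gen a).
Proof.
move=> vx; have [Sx h0 _] := (charney_vertexP x).1 vx.
have [x1|/split_last[x' [a Ex]]] := pselect (x = 1).
  by move: h0; rewrite heads_eq0 => /asboolP.
exists a; apply: reach_step => //; first exact: gen_vertex vx _.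
apply: normal_step_heads => // b; rewrite heads_gen inE => /eqP ->.
by rewrite Ex; apply: leR_mull.
Qed.

(** * Moving tokens *)

Definition commuting_heads s y : {set Sigma} :=
  [set c in heads y | l s c == Some 2]%SET.

(** Here D is the least upper bound of the first letters of y, and w is a
    longest element of the submonoid that they generate with s w in S.  The
    length of w is bounded since w is squarefree, hence divides D. *)
Lemma predecessor y s t : vertex y -> s \notin heads y -> t \in heads y ->
  l s t <> Some 2 -> exists x, [/\ vertex x, reach x y, s \in heads x &
    heads x \subset s |: commuting_heads s y].
Proof.
move=> vy sy ty lst; have [Sy h0 hT] := (charney_vertexP y).1 vy.
have [D [SD ID DI Dy]] := delta_exists y.
have hD : heads D = heads y.
  apply/setP => a; apply/headsP/idP => [aD|]; last exact: DI.
  by apply/headsP; apply: leL_trans Dy.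
have vD : vertex D by apply/charney_vertexP; rewrite hD.
have Dtail := delta_tails SD ID DI.
have Dy' : reach D y by apply: reach_step => //; apply: normal_step_heads.
pose P n := `[< exists w, [/\ len w = n, supported (heads y) w & S (gen s * w)] >].
have P0 : exists n, P n.
  exists 0; apply/asboolP; exists 1; split; first exact: len1.
    by rewrite -class_nil supported_class.
  by rewrite mulg1; apply: garside_gen.
have Pmax n : P n -> n <= len D.
  move=> /asboolP[w [<- wI /garside_suffix Sw]]; apply: leL_len.
  exact: (squarefree_dominated (garside_squarefree Sw) wI).
have [_ /asboolP[w [<- wI Ssw]] wmax] := ex_maxnP P0 Pmax.
have sx : s \in heads (gen s * w) by apply/headsP/leL_mulr.
have hx : heads (gen s * w) \subset s |: commuting_heads s y.
  apply/subsetP => a ax; rewrite in_setU1; have [//|a_s /=] := eqVneq a s.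
  have [n lsa [r Ew]] := heads_gen_mul ax a_s.
  move: wI; rewrite Ew supportedM // supported_class // => /andP[+ _].
  (* A label above 2 would make s occur in w. *)
  have := label_gt1 Hl lsa; case: n lsa {Ew} => [|[|[|n]]] //= lsa _.
    by rewrite andbT [in X in _ -> X]inE lsa eqxx andbT.
  by case/and3P=> _ sI _; case/negP: sy; exact: sI.
have vx : vertex (gen s * w).
  apply/charney_vertexP; split=> //; first by apply/set0Pn; exists s.
  apply/eqP => xT; have : t \in heads (gen s * w) by rewrite xT inE.
  move/(subsetP hx); rewrite !inE => /orP[/eqP ts|/andP[_ /eqP //]].
  by rewrite -ts ty in sy.
exists (gen s * w); split=> //; apply: rt_trans Dy'; apply: reach_step => //.
apply: normal_step_of => // u u1 [r ED]; rewrite -mulgA => Swu; apply: u1.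
have uI : supported (heads y) u by move: ID; rewrite ED supportedM // => /andP[].
have : P (len (w * u)) by apply/asboolP; exists (w * u); rewrite supportedM // wI.
move/wmax; rewrite lenM // -[X in _ <= X]addn0 leq_add2l leqn0 => /eqP.
exact: len_eq0.
Qed.

(** In terms of tokens, the one on t slides to s unless their number drops. *)
Lemma predecessor_slide y s t : vertex y -> s \notin heads y -> t \in heads y ->
  l s t <> Some 2 -> exists x, [/\ vertex x, reach x y &
    #|heads x| < #|heads y| \/
    heads x = s |: heads y :\ t /\ #|heads x| = #|heads y|].
Proof.
move=> vy sy ty lst; have [x [vx xy sx hx]] := predecessor vy sy ty lst.
exists x; split=> //; case: ltnP => [_|card_le]; [by left|right].
have sub : s |: commuting_heads s y \subset s |: heads y :\ t.
  apply: setUS; apply/subsetP => c; rewrite !inE => /andP[-> /eqP lsc].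
  by rewrite andbT; apply: contra_not_neq lst => <-.
have card : #|s |: heads y :\ t| = #|heads y|.
  by rewrite cardsU1 in_setD1 (negbTE sy) andbF /= [in RHS](cardsD1 t) ty.
have hx' := subset_trans hx sub.
have E : heads x = s |: heads y :\ t.
  by apply/eqP; rewrite eqEcard hx' card.
by rewrite E card.
Qed.

(** Two tokens next to the same empty site s merge. *)
Lemma predecessor_merge y s t t' : vertex y -> s \notin heads y ->
  t \in heads y -> t' \in heads y -> t != t' ->
  l s t <> Some 2 -> l s t' <> Some 2 ->
  exists x, [/\ vertex x, reach x y & #|heads x| < #|heads y|].
Proof.
move=> vy sy ty t'y tt' lst lst'.
have [x [vx xy sx hx]] := predecessor vy sy ty lst.
exists x; split=> //; apply: (leq_ltn_trans (subset_leq_card hx)).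
rewrite cardsU1 [X in _ < X](cardsD1 t) ty [X in _ < _ + X](cardsD1 t').
rewrite in_setD1 (eq_sym t') tt' t'y /= ltnS.
apply: leq_add; first by case: (_ \notin _).
apply: subset_leq_card; apply/subsetP => c; rewrite !inE => /andP[-> /eqP lsc].
by rewrite andbT; apply/andP; split; [apply: contra_not_neq lst' => <-|
  apply: contra_not_neq lst => <-].
Qed.

Definition linked : rel Sigma := fun s t => (s != t) && (l s t != Some 2).

Lemma linked_connect s t : at_irreducible A -> connect linked s t.
Proof.
move=> irr; pose J := [set c | connect linked s c]%SET.
have [JT | JT] := eqVneq J setT.
  have : t \in J by rewrite JT inE.
  by rewrite inE.
have J0 : J != set0 by apply/set0Pn; exists s; rewrite inE connect0.
have [a [b [aJ bJ lab]]] := irreducible_cut Hl irr J0 JT.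
case/negP: (aJ); move: (bJ); rewrite !inE => sb.
apply: (connect_trans sb); apply: connect1; apply/andP; split.
  by apply: contraNneq aJ => <-.
by rewrite (label_sym Hl); apply/eqP.
Qed.

Lemma linked_sym s t : linked s t = linked t s.
Proof. by rewrite /linked eq_sym (label_sym Hl). Qed.

Lemma linked_label s t : linked s t -> l s t <> Some 2.
Proof. by case/andP => _ /eqP. Qed.

(** Induction on the number of tokens.  If two tokens are adjacent, there are
    adjacent tokens r, r' with r next to an empty site s: slide r to s, then merge
    s and r' at r.  If no two are adjacent, slide a token along a path towards
    another one until it becomes adjacent to some token. *)
Lemma reach_from_gen y : at_irreducible A -> vertex y -> exists a, reach (gen a) y.
Proof.
move=> irr; have [m] := ubnP #|heads y|; elim: m y => // m IH y ym vy.
have smaller z x : reach z y -> #|heads z| <= m -> vertex x -> reach x z ->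
    #|heads x| < #|heads z| -> exists a, reach (gen a) y.
  move=> zy zm vx xz xlt; have [a ax] := IH x (leq_trans xlt zm) vx.
  by exists a; apply: rt_trans ax _; apply: rt_trans xz zy.
have adjacent z t t' : vertex z -> reach z y -> #|heads z| <= m ->
    t \in heads z -> t' \in heads z -> linked t t' -> exists a, reach (gen a) y.
  move=> vz zy zm tz t'z tt'.
  (* A site outside J linked to J cannot carry a token, as it would be in J. *)
  pose J := [set c in heads z | [exists d in heads z, linked c d]]%SET.
  have tJ : t \in J by rewrite in_set tz; apply/existsP; exists t'; rewrite t'z.
  have Jz : J \subset heads z by apply/subsetP => c; rewrite in_set => /andP[].
  have JT : J != setT.
    have [_ _] := (charney_vertexP z).1 vz; apply: contraNneq => JT.
    by rewrite -subTset -JT.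
  have J0 : J != set0 by apply/set0Pn; exists t.
  have [s [r [sJ rJ lsr]]] := irreducible_cut Hl irr J0 JT.
  move: (rJ); rewrite in_set => /andP[rz /existsP[r' /andP[r'z rr']]].
  have sr : linked s r.
    by apply/andP; split; [apply: contraNneq sJ => -> | apply/eqP].
  have sz : s \notin heads z.
    apply: contra sJ => sz; rewrite in_set sz; apply/existsP; exists r.
    by rewrite rz.
  have [x [vx xz [xlt|[hx xc]]]] := predecessor_slide vz sz rz lsr.
    exact: smaller zy zm vx xz xlt.
  have r'r : r' != r by case/andP: rr'; rewrite eq_sym.
  have rx : r \notin heads x.
    by rewrite hx in_setU1 in_setD1 eqxx orbF; case/andP: sr; rewrite eq_sym.
  have sx : s \in heads x by rewrite hx in_setU1 eqxx.
  have r'x : r' \in heads x by rewrite hx in_setU1 in_setD1 r'r r'z orbT.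
  have sr' : s != r' by apply: contraNneq sz => ->.
  have rs : l r s <> Some 2 by rewrite (label_sym Hl).
  have [x' [vx' x'x x'lt]] := predecessor_merge vx rx sx r'x sr' rs (linked_label rr').
  apply: (smaller x x' _ _ vx' x'x x'lt); last by rewrite xc.
  exact: rt_trans xz zy.
have along p : forall z t, vertex z -> reach z y -> #|heads z| <= m ->
    t \in heads z -> last t p \in heads z -> last t p != t -> path linked t p ->
    exists a, reach (gen a) y.
  elim: p => [|s p IHp] z t vz zy zm tz lz lt; first by rewrite eqxx in lt.
  case/andP => ts sp; have [sz | sz] := boolP (s \in heads z).
    exact: adjacent zy zm tz sz ts.
  have lst : l s t <> Some 2 by apply: linked_label; rewrite linked_sym.
  have [x [vx xz [xlt|[hx xc]]]] := predecessor_slide vz sz tz lst.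
    exact: smaller zy zm vx xz xlt.
  apply: (IHp x s) => //; rewrite ?xc //.
  - exact: rt_trans xz zy.
  - by rewrite hx in_setU1 eqxx.
  - by rewrite hx in_setU1 in_setD1 lt lz orbT.
  - by apply: contraNneq sz => <-.
have [Sy h0 hT] := (charney_vertexP y).1 vy.
have [t ty] := set0Pn _ h0.
have [yt | ] := eqVneq (heads y) [set t].
  exists t; apply: reach_step => //; first exact: gen_vertex vy _.
  apply: normal_step_heads => //; first exact: garside_gen.
  by move=> a; rewrite yt inE => /eqP ->; exists 1; rewrite mul1g.
rewrite eqEsubset sub1set ty andbT => /subsetPn[t' t'y]; rewrite inE => t't.
have /connectP[p pp Ep] := linked_connect t t' irr.
by apply: (along p y t) => //; rewrite -?Ep //; apply: rt_refl.
Qed.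

End Charney.

Theorem theorem2p12 (Sigma : finType) (l : Sigma -> Sigma -> option nat)
    (Hl : artin_tits_label l) (Hirr : at_irreducible (artin_tits l)) :
  strongly_connected (charney_vertex l) (charney_edge l).
Proof.
move=> x y vx vy.
have [a xa] := reach_last Hl vx; have [b yb] := reach_from_gen Hl Hirr vy.
apply: rt_trans xa (rt_trans _ _ _ _ _ _ yb).
exact: (reach_gens Hl vx Hirr).
Qed.
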